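(* For all integers $m>k\ge0$ and all $0<z<\frac{\pi}{2}$, the normalized log-sine integral $\operatorname{ls}_m^{(k)}(z)$ is expressible in terms of Nielsen polylogarithms; explicitly, $$\frac{\operatorname{ls}_m^{(k)}(z)}{(m-k-1)!}=\sum_{j=0}^{m-k-1}\sum_{r=0}^{j}\frac{(k+j-r)!}{r!\,(j-r)!}\,\frac{(-1)^{m+j+r+1}\,i^{\,r+k+1}}{2^{k+j+1-r}}\,z^r\,S_{m-k-1-j,\;k+j+1-r}(1-e^{-2iz}).$$
   Context: For integers $0\le k<m$ and $0<z\le\frac{\pi}{2}$, the normalized log-sine integral is $$\operatorname{ls}_m^{(k)}(z)= -\int_0^z t^k\left(\log\frac{\sin t}{\sin z}\right)^{m-1-k}dt.$$ For integers $m,k\ge1$ and $x\in\mathbb{C}\setminus[1,\infty)$ the Nielsen polylogarithm is $$S_{m,k}(x)=\frac{(-1)^{m+k-1}}{(m-1)!\,k!}\int_0^1 \log(t)^{m-1}\log(1-xt)^k\,\frac{dt}{t}$$ with the principal branch of the logarithm. For $|x|<1$, $S_{m,k}(x)=\operatorname{Li}_{m+1,\{1\}^{k-1}}(x)$, where $\operatorname{Li}_{s_1,\dots,s_k}(x)=\sum_{n_1>\cdots>n_k>0}\frac{x^{n_1}}{n_1^{s_1}\cdots n_k^{s_k}}$ and $\{1\}^{k}$ means $1$ repeated $k$ times. For $m=0$ and $k\ge1$ one sets $S_{0,k}(x)=\operatorname{Li}_{\{1\}^k}(x)=\frac{(-1)^k}{k!}\log(1-x)^k$ (principal branch). *)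

(* Defs.v *)
From Stdlib Require Import Reals Lra Lia Factorial.
From Coquelicot Require Import Coquelicot.

Open Scope R_scope.

Definition Cexp (w : C) : C :=
  (exp (Re w) * cos (Im w), exp (Re w) * sin (Im w)).

(* Principal argument, with values in (-PI, PI] (arbitrary at 0). *)
Definition Carg (w : C) : R :=
  if Rle_dec 0 (Im w) then acos (Re w / Cmod w) else - acos (Re w / Cmod w).

(* Principal branch of the complex logarithm (arbitrary at 0). *)
Definition Clog (w : C) : C := (ln (Cmod w), Carg w).

(* The integral is improper at 0 when the logarithm occurs. *)
Definition ls (m k : nat) (z : R) : R :=
  - RInt_gen (fun t : R => t ^ k * ln (sin t / sin z) ^ (m - 1 - k))
      (at_right 0) (at_point z).

(* Used for k >= 1 and x outside [1, +oo).  For m >= 1 this is the integral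
   over (0, 1], improper at 0, of a complex-valued function of a real
   variable; m = 0 is the conventional value, the logarithmic
   closed form of Li_{1,...,1}. *)
Definition nielsen (m k : nat) (x : C) : C :=
  match m with
  | O => ((-1) ^ k / INR (fact k) * Clog (1 - x) ^ k)%C
  | S _ =>
      ((-1) ^ (m + k - 1) / (INR (fact (m - 1)) * INR (fact k)) *
       @RInt_gen C_R_CompleteNormedModule
         (fun t : R => (ln t ^ (m - 1))%R * Clog (1 - x * t) ^ k / t)
         (at_right 0) (at_point 1))%C
  end.

Lemma Cmod_sqr (w : C) : Cmod w * Cmod w = Re w * Re w + Im w * Im w.
Proof.
  unfold Cmod, Re, Im. rewrite sqrt_sqrt; simpl; nra.
Qed.

Lemma Cmod_div_bounds (w : C) : w <> 0%C -> -1 <= Re w / Cmod w <= 1.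
Proof.
  intros Hw. assert (H := Cmod_gt_0 w). destruct H as [H _]. specialize (H Hw).
  assert (Hs := Cmod_sqr w).
  split.
  - apply Rmult_le_reg_r with (Cmod w); trivial.
    unfold Rdiv. rewrite Rmult_assoc, Rinv_l by lra. nra.
  - apply Rmult_le_reg_r with (Cmod w); trivial.
    unfold Rdiv. rewrite Rmult_assoc, Rinv_l by lra. nra.
Qed.

Lemma Carg_bounds (w : C) : w <> 0%C -> - PI < Carg w <= PI.
Proof.
  intros Hw. assert (Hp := PI_RGT_0).
  assert (Hb := acos_bound (Re w / Cmod w)).
  unfold Carg. destruct (Rle_dec 0 (Im w)) as [Hi | Hi]; [lra | ].
  split; [ | lra].
  destruct (Req_dec (acos (Re w / Cmod w)) PI) as [E | E]; [ | lra].
  exfalso.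
  assert (Hc := cos_acos _ (Cmod_div_bounds w Hw)).
  rewrite E, cos_PI in Hc.
  assert (H : 0 < Cmod w) by (apply Cmod_gt_0; trivial).
  assert (Hs := Cmod_sqr w).
  assert (Hr : Re w = - Cmod w).
  { replace (Re w) with (Re w / Cmod w * Cmod w) by (field; lra).
    rewrite <- Hc. ring. }
  rewrite Hr in Hs. nra.
Qed.

Lemma Cexp_Clog (w : C) : w <> 0%C -> Cexp (Clog w) = w.
Proof.
  intros Hw.
  assert (H : 0 < Cmod w) by (apply Cmod_gt_0; trivial).
  assert (Hb := Cmod_div_bounds w Hw).
  assert (Hs := Cmod_sqr w).
  assert (Hq : sqrt (1 - (Re w / Cmod w)²) = Rabs (Im w) / Cmod w).
  { replace (1 - (Re w / Cmod w)²) with (Rsqr (Im w / Cmod w)).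
    - rewrite sqrt_Rsqr_abs, Rabs_div by lra.
      rewrite (Rabs_pos_eq (Cmod w)) by lra. reflexivity.
    - assert (E : Im w * Im w = Cmod w * Cmod w - Re w * Re w) by lra.
      unfold Rsqr.
      replace (Im w / Cmod w * (Im w / Cmod w))
        with (Im w * Im w / (Cmod w * Cmod w)) by (field; lra).
      rewrite E. field. lra. }
  unfold Cexp, Clog. change (Re (ln (Cmod w), Carg w)) with (ln (Cmod w)).
  change (Im (ln (Cmod w), Carg w)) with (Carg w).
  rewrite exp_ln by trivial.
  rewrite (surjective_pairing w) at 5. change (fst w) with (Re w).
  change (snd w) with (Im w).
  unfold Carg. destruct (Rle_dec 0 (Im w)) as [Hi | Hi];
    rewrite ?cos_neg, ?sin_neg, cos_acos, sin_acos, Hq by trivial.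
  - rewrite Rabs_pos_eq by trivial. f_equal; field; lra.
  - rewrite Rabs_left by lra. f_equal; field; lra.
Qed.

(* Main.v *)
Require Import Defs.
From Stdlib Require Import Reals Factorial Lra Lia ClassicalEpsilon.
From Coquelicot Require Import Coquelicot.
Open Scope R_scope.

(** Let [w = 1 - exp (-2it)].  Then [log (1 - w) = -2it], and
    [log (sin t / sin z) + i (z - t)] is a branch of [log (w / x)], where
    [x = 1 - exp (-2iz)] is the point [t = z] of this arc.  So on the arc a power
    [t ^ p] times a power of this logarithm is, up to a constant, what the
    Nielsen integral of [log (w / x) ^ (a - 1) * log (1 - w) ^ b / w] becomes after
    one integration by parts, except that the Nielsen integral runs along the
    segment from [0] to [x] instead of the arc.  Once the two paths are known to
    give the same value (lemma [is_RInt_gen_nielsen]), the theorem is algebra: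
    [log (sin t / sin z)] is [log (w / x) + i (t - z)], and the binomial theorem,
    applied to this sum and then to the powers of [t - z], writes the log-sine
    integrand as a combination of such products
    ([log_sine_power_expansion]).

    The independence of the path is the main point.  From here on let
    [w = s * (1 - exp (-2it))].  For [0 < s] and [0 < t < PI / 2] these points lie
    in the open upper half-plane, where [log (1 - w)] is smooth, and both paths are
    coordinate lines of the chart [(s, t)]: the segment is [t = z], the arc is
    [s = 1].  There is a sequence of functions [P 0 = log (1 - w) ^ b], [P 1],
    [P 2], ... each of which has the preceding one as its image under [w * d/dw]
    and tends to [0] at the origin ([euler_chain]).  The sequence is built by
    integrating closed forms on a rectangle ([closed_form_primitive]); bounds
    [|P j| <= M * s * t], for [s <= 1] and [t <= z], fix the constants of
    integration.  On either path, repeated integration by parts against powers of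
    the logarithm walks up the sequence and ends with a multiple of the value of
    [P a] at the common end point [x] ([is_RInt_gen_log_moment]), so that the two
    integrals can be compared. *)

(** * Complex-valued functions of real variables *)

Notation is_derive_C := (@is_derive R_AbsRing C_R_NormedModule).
Notation continuous_C := (@continuous _ C_R_NormedModule).

Lemma is_derive_C_iff (f : R -> C) (t : R) (l : C) :
  is_derive_C f t l <->
  is_derive (fun x => Re (f x)) t (Re l) /\
  is_derive (fun x => Im (f x)) t (Im l).
Proof.
  split.
  - intros H. split.
    + apply (filterdiff_comp' (K := R_AbsRing) (V := C_R_NormedModule)
               (W := R_NormedModule) f Re t (fun y => scal y l) Re H).
      apply filterdiff_linear, (is_linear_fst (U := R_NormedModule) (V := R_NormedModule)).
    + apply (filterdiff_comp' (K := R_AbsRing) (V := C_R_NormedModule)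
               (W := R_NormedModule) f Im t (fun y => scal y l) Im H).
      apply filterdiff_linear, (is_linear_snd (U := R_NormedModule) (V := R_NormedModule)).
  - intros [H1 H2].
    assert (H1' := is_derive_scal_l (V := C_R_NormedModule) _ _ _ (RtoC 1) H1).
    assert (H2' := is_derive_scal_l (V := C_R_NormedModule) _ _ _ Ci H2).
    assert (H := is_derive_plus _ _ _ _ _ H1' H2').
    refine (eq_ind_r (fun l => is_derive_C f t l) (is_derive_ext _ f _ _ _ H) _).
    + intros x.
      change (@eq C (Re (f x) * 1 + Im (f x) * 0, Re (f x) * 0 + Im (f x) * 1) (f x)).
      rewrite (surjective_pairing (f x)) at 5. unfold Re, Im. f_equal; ring.
    + change (l = (Re l * 1 + Im l * 0, Re l * 0 + Im l * 1)).
      rewrite (surjective_pairing l) at 1. unfold Re, Im. f_equal; ring.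
Qed.

Lemma continuous_C_iff {U : UniformSpace} (f : U -> C) (x : U) :
  continuous_C f x <->
  continuous (fun y => Re (f y)) x /\ continuous (fun y => Im (f y)) x.
Proof.
  split.
  - intros H. split.
    + apply (continuous_comp (V := C_R_NormedModule) f Re x H).
      apply (continuous_fst (U := R_UniformSpace) (V := R_UniformSpace)).
    + apply (continuous_comp (V := C_R_NormedModule) f Im x H).
      apply (continuous_snd (U := R_UniformSpace) (V := R_UniformSpace)).
  - intros [H1 H2].
    apply (continuous_ext (fun y => (Re (f y), Im (f y)))).
    { intros y. symmetry. apply surjective_pairing. }
    apply (continuous_comp_2 (X := C_R_NormedModule) _ _ pair x H1 H2).
    apply (continuous_ext (fun y : R * R => y)).
    { intros y. apply surjective_pairing. }
    apply continuous_id.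
Qed.

Lemma is_derive_C_continuous (f : R -> C) (t : R) (l : C) :
  is_derive_C f t l -> continuous_C f t.
Proof. intros H. apply @ex_derive_continuous. exists l. exact H. Qed.

Lemma is_derive_C_eq (f : R -> C) (t : R) (l l' : C) :
  is_derive_C f t l' -> l' = l -> is_derive_C f t l.
Proof. intros H <-. exact H. Qed.

Lemma is_derive_Cmult (f g : R -> C) (t : R) (lf lg : C) :
  is_derive_C f t lf -> is_derive_C g t lg ->
  is_derive_C (fun x => f x * g x)%C t (lf * g t + f t * lg)%C.
Proof.
  rewrite !is_derive_C_iff. intros [F1 F2] [G1 G2]. split.
  - eapply (eq_ind _ (is_derive (V := R_NormedModule) _ t)).
    + apply (is_derive_minus (V := R_NormedModule)
        (fun x => Re (f x) * Re (g x)) (fun x => Im (f x) * Im (g x)) t _ _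
        (is_derive_mult (K := R_AbsRing) (fun x => Re (f x)) (fun x => Re (g x))
           t _ _ F1 G1 Rmult_comm)
        (is_derive_mult (K := R_AbsRing) (fun x => Im (f x)) (fun x => Im (g x))
           t _ _ F2 G2 Rmult_comm)).
    + unfold minus, plus, opp, mult; simpl. unfold Re, Im. ring.
  - eapply (eq_ind _ (is_derive (V := R_NormedModule) _ t)).
    + apply (is_derive_plus (V := R_NormedModule)
        (fun x => Re (f x) * Im (g x)) (fun x => Im (f x) * Re (g x)) t _ _
        (is_derive_mult (K := R_AbsRing) (fun x => Re (f x)) (fun x => Im (g x))
           t _ _ F1 G2 Rmult_comm)
        (is_derive_mult (K := R_AbsRing) (fun x => Im (f x)) (fun x => Re (g x))
           t _ _ F2 G1 Rmult_comm)).
    + unfold minus, plus, opp, mult; simpl. unfold Re, Im. ring.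
Qed.

Lemma is_derive_C_const (c : C) (t : R) : is_derive_C (fun _ => c) t (RtoC 0).
Proof. apply (is_derive_const (V := C_R_NormedModule)). Qed.

Lemma is_derive_Cpow (f : R -> C) (t : R) (l : C) (n : nat) :
  is_derive_C f t l ->
  is_derive_C (fun x => f x ^ n)%C t (INR n * f t ^ (n - 1) * l)%C.
Proof.
  intros H. induction n as [| n IH].
  - apply is_derive_C_eq with (RtoC 0); [exact (is_derive_C_const 1 t) |].
    simpl INR. ring.
  - eapply is_derive_C_eq. { exact (is_derive_Cmult _ _ _ _ _ H IH). }
    rewrite S_INR, RtoC_plus. destruct n as [| n].
    + simpl. ring.
    + replace (S (S n) - 1)%nat with (S n) by lia.
      replace (S n - 1)%nat with n by lia. simpl Cpow. ring.
Qed.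

Lemma is_derive_RtoC (f : R -> R) (t l : R) :
  is_derive f t l -> is_derive_C (fun x => RtoC (f x)) t (RtoC l).
Proof.
  intros H. apply is_derive_C_iff. split; [exact H |].
  exact (is_derive_const (V := R_NormedModule) 0 t).
Qed.

Lemma continuous_Cmult {U : UniformSpace} (f g : U -> C) (x : U) :
  continuous_C f x -> continuous_C g x -> continuous_C (fun y => f y * g y)%C x.
Proof.
  rewrite !continuous_C_iff. intros [F1 F2] [G1 G2]. split.
  - apply (continuous_minus (V := R_NormedModule)
      (fun y => Re (f y) * Re (g y)) (fun y => Im (f y) * Im (g y)));
      apply (continuous_mult (K := R_AbsRing)); assumption.
  - apply (continuous_plus (V := R_NormedModule)
      (fun y => Re (f y) * Im (g y)) (fun y => Im (f y) * Re (g y)));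
      apply (continuous_mult (K := R_AbsRing)); assumption.
Qed.

Lemma continuous_Cpow {U : UniformSpace} (f : U -> C) (x : U) (n : nat) :
  continuous_C f x -> continuous_C (fun y => f y ^ n)%C x.
Proof.
  intros H. induction n as [| n IH].
  - exact (continuous_const (V := C_R_NormedModule) (RtoC 1) x).
  - exact (continuous_Cmult _ _ _ H IH).
Qed.

Lemma continuous_RtoC {U : UniformSpace} (f : U -> R) (x : U) :
  continuous f x -> continuous_C (fun y => RtoC (f y)) x.
Proof.
  intros H. apply continuous_C_iff. split; [exact H |].
  exact (continuous_const (V := R_UniformSpace) 0 x).
Qed.

Lemma continuous_Rinv {U : UniformSpace} (f : U -> R) (x : U) :
  continuous f x -> f x <> 0 -> continuous (fun y => / f y) x.
Proof.
  intros H H0. apply (continuous_comp f Rinv x H).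
  apply (ex_derive_continuous (V := R_NormedModule)).
  exists (- 1 / (f x) ^ 2).
  apply (is_derive_inv (fun y => y) (f x) 1);
    [apply (is_derive_id (K := R_AbsRing)) | exact H0].
Qed.

Lemma Re_sqr_plus_Im_sqr_neq_0 (w : C) : w <> 0%C -> Re w ^ 2 + Im w ^ 2 <> 0.
Proof.
  intros H H'. apply H. destruct w as [a b]. simpl in *.
  assert (a = 0) by nra. assert (b = 0) by nra. subst. reflexivity.
Qed.

Lemma continuous_Cinv {U : UniformSpace} (f : U -> C) (x : U) :
  continuous_C f x -> f x <> 0%C -> continuous_C (fun y => / f y)%C x.
Proof.
  rewrite !continuous_C_iff. intros [F1 F2] H0.
  assert (N : continuous (fun y => / (Re (f y) ^ 2 + Im (f y) ^ 2)) x).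
  { apply continuous_Rinv; [| apply Re_sqr_plus_Im_sqr_neq_0, H0].
    apply (continuous_plus (V := R_NormedModule) (fun y => Re (f y) ^ 2) (fun y => Im (f y) ^ 2)).
    - apply (continuous_comp (fun y => Re (f y)) (fun u => u ^ 2) x F1).
      apply (ex_derive_continuous (V := R_NormedModule)). auto_derive. trivial.
    - apply (continuous_comp (fun y => Im (f y)) (fun u => u ^ 2) x F2).
      apply (ex_derive_continuous (V := R_NormedModule)). auto_derive. trivial. }
  split.
  - apply (continuous_mult (K := R_AbsRing) (fun y => Re (f y))); assumption.
  - apply (continuous_mult (K := R_AbsRing) (fun y => - Im (f y))); [| assumption].
    apply (continuous_opp (V := R_NormedModule)), F2.
Qed.

Lemma RtoC_neq_0 (s : R) : s <> 0 -> RtoC s <> 0%C.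
Proof. intros H E. apply H. injection E. trivial. Qed.

Lemma is_derive_Cdiv_id (f : R -> C) (t : R) (l : C) :
  t <> 0 -> is_derive_C f t l ->
  is_derive_C (fun x => f x / RtoC x)%C t (l / t - f t / (t * t))%C.
Proof.
  intros H0 H.
  assert (N : RtoC t <> 0%C) by (apply RtoC_neq_0, H0).
  assert (I : is_derive_C (fun x => RtoC (/ x)) t (RtoC (- 1 / t ^ 2))).
  { apply is_derive_RtoC.
    exact (is_derive_inv (fun y => y) t 1 (is_derive_id t) H0). }
  apply (is_derive_ext_loc (V := C_R_NormedModule) (fun x => f x * RtoC (/ x))%C).
  { apply (filter_imp (fun x => x <> 0)).
    - intros x Hx. rewrite RtoC_inv by assumption. reflexivity.
    - exact (open_neq 0 t H0). }
  eapply is_derive_C_eq. { exact (is_derive_Cmult _ _ _ _ _ H I). }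
  rewrite RtoC_div, RtoC_pow, RtoC_inv by
    (try apply pow_nonzero; assumption).
  field. assumption.
Qed.

(** Mean value inequality: apply the real theorem to the component of [f] along
    the increment [f y - f x]. *)
Lemma Cmod_increment_le (f f' : R -> C) (M x y : R) :
  x <= y ->
  (forall u, x <= u <= y -> is_derive_C f u (f' u)) ->
  (forall u, x <= u <= y -> Cmod (f' u) <= M) ->
  Cmod (f y - f x) <= M * (y - x).
Proof.
  intros Hxy Hd HM.
  set (d := (f y - f x)%C).
  set (g := fun u => Re d * Re (f u) + Im d * Im (f u)).
  set (g' := fun u => Re d * Re (f' u) + Im d * Im (f' u)).
  assert (Hg : forall u, x <= u <= y -> is_derive g u (g' u)).
  { intros u Hu. destruct (proj1 (is_derive_C_iff _ _ _) (Hd u Hu)) as [H1 H2].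
    apply (is_derive_plus (V := R_NormedModule)
      (fun u => Re d * Re (f u)) (fun u => Im d * Im (f u)));
      apply is_derive_scal; assumption. }
  destruct (MVT_gen g x y g') as [xi [Hxi E]].
  { intros u. rewrite Rmin_left, Rmax_right by lra. intros Hu. apply Hg. lra. }
  { intros u. rewrite Rmin_left, Rmax_right by lra. intros Hu.
    apply continuity_pt_filterlim, (ex_derive_continuous (V := R_NormedModule)).
    exists (g' u). apply Hg, Hu. }
  rewrite Rmin_left, Rmax_right in Hxi by lra.
  assert (E2 : Cmod d * Cmod d = g' xi * (y - x)).
  { rewrite <- E, Cmod_sqr. unfold g, d. simpl. unfold Re, Im. ring. }
  assert (CS : g' xi <= Cmod d * Cmod (f' xi)).
  { apply Rsqr_incr_0_var; [| apply Rmult_le_pos; apply Cmod_ge_0].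
    unfold Rsqr. replace (Cmod d * Cmod (f' xi) * (Cmod d * Cmod (f' xi))) with
      ((Cmod d * Cmod d) * (Cmod (f' xi) * Cmod (f' xi))) by ring.
    rewrite !Cmod_sqr. unfold g'.
    assert (0 <= (Re d * Im (f' xi) - Im d * Re (f' xi)) ^ 2) by apply pow2_ge_0. nra. }
  assert (HMx := HM xi Hxi). assert (Hd0 := Cmod_ge_0 d).
  destruct (Req_dec (Cmod d) 0) as [Z | NZ].
  - rewrite Z. apply Rmult_le_pos; [| lra]. assert (H := Cmod_ge_0 (f' xi)). lra.
  - apply Rmult_le_reg_l with (Cmod d); [lra |]. rewrite E2.
    assert (Cmod d * Cmod (f' xi) <= Cmod d * M) by (apply Rmult_le_compat_l; assumption).
    replace (Cmod d * (M * (y - x))) with ((Cmod d * M) * (y - x)) by ring.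
    apply Rmult_le_compat_r; lra.
Qed.

(** * Integrals against powers of a logarithm, improper at 0 *)

Lemma at_right_interval (e : R) : 0 < e -> at_right 0 (fun u => 0 < u < e).
Proof.
  intros He. exists (mkposreal e He). intros u Hu Hu0. simpl in Hu.
  unfold ball in Hu; simpl in Hu; unfold AbsRing_ball, abs, minus, plus, opp in Hu;
  simpl in Hu. apply Rabs_def2 in Hu. lra.
Qed.

(** Boundary terms at [0] are products of a linearly small function and a power
    of a logarithm; [sqrt u] is a common bound for all of them. *)
Lemma filterlim_sqrt_bound (F : R -> C) (e M : R) :
  0 < e -> (forall u, 0 < u <= e -> Cmod (F u) <= M * sqrt u) ->
  filterlim F (at_right 0) (locally (T := C_R_NormedModule) (RtoC 0)).
Proof.
  intros He HM.
  apply (filterlim_locally_ball_norm (U := C_R_NormedModule)).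
  intros eps.
  set (d := Rmin e (Rsqr (eps / (Rabs M + 1)))).
  assert (HA : 0 < Rabs M + 1) by (assert (H := Rabs_pos M); lra).
  assert (Hq : 0 < eps / (Rabs M + 1)) by (apply Rdiv_lt_0_compat; [apply cond_pos | lra]).
  assert (Hd : 0 < d) by (apply Rmin_pos; [assumption | apply Rlt_0_sqr; lra]).
  generalize (at_right_interval d Hd). apply filter_imp. intros u [Hu0 Hu'].
  assert (u < e) by (eapply Rlt_le_trans; [exact Hu' | apply Rmin_l]).
  assert (Hs : u < Rsqr (eps / (Rabs M + 1)))
    by (eapply Rlt_le_trans; [exact Hu' | apply Rmin_r]).
  apply sqrt_lt_1 in Hs; [| lra | apply Rle_0_sqr].
  rewrite sqrt_Rsqr in Hs by lra.
  change (@norm R_AbsRing C_R_NormedModule (F u - 0)%C < eps).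
  rewrite <- Cmod_norm.
  replace (F u - 0)%C with (F u) by ring.
  assert (HF := HM u). assert (Hsu : 0 < sqrt u) by (apply sqrt_lt_R0; lra).
  assert (M <= Rabs M) by apply Rle_abs.
  apply Rle_lt_trans with (M * sqrt u); [apply HF; lra |].
  apply Rlt_le_trans with ((Rabs M + 1) * (eps / (Rabs M + 1))).
  - apply Rlt_trans with ((Rabs M + 1) * sqrt u); nra.
  - right. field. lra.
Qed.

Lemma is_RInt_gen_primitive (F phi : R -> C) (e : R) :
  0 < e ->
  (forall u, 0 < u <= e -> is_derive_C F u (phi u)) ->
  (forall u, 0 < u <= e -> continuous_C phi u) ->
  filterlim F (at_right 0) (locally (T := C_R_NormedModule) (RtoC 0)) ->
  @is_RInt_gen C_R_NormedModule phi (at_right 0) (at_point e) (F e).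
Proof.
  intros He Hd Hc Hl P HP.
  assert (Hl' : filterlim (fun u => @minus C_R_NormedModule (F e) (F u)) (at_right 0)
                  (locally (T := C_R_NormedModule) (F e))).
  { replace (locally (T := C_R_NormedModule) (F e)) with
      (locally (T := C_R_NormedModule) (@minus C_R_NormedModule (F e) (RtoC 0))).
    - apply (filterlim_comp_2 (F := at_right 0) (fun _ => F e) (fun u => opp (F u))
               (@plus C_R_NormedModule) (filterlim_const _)
               (filterlim_comp _ _ _ F opp _ _ _ Hl (filterlim_opp (RtoC 0)))).
      exact (filterlim_plus (V := C_R_NormedModule) (F e) (opp (RtoC 0))).

    - f_equal. change (F e - 0 = F e)%C. ring. }
  assert (HQ := Hl' P HP). unfold filtermap in HQ.
  unfold filtermapi.
  apply (Filter_prod _ _ _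
           (fun a => 0 < a <= e /\ P (@minus C_R_NormedModule (F e) (F a)))
           (fun b => b = e)).
  - apply filter_and; [| exact HQ].
    generalize (at_right_interval e He). apply filter_imp. intros u Hu. lra.
  - reflexivity.
  - intros a b [Ha HPa] ->. exists (@minus C_R_NormedModule (F e) (F a)).
    split; [| exact HPa]. simpl.
    apply (is_RInt_derive (V := C_R_CompleteNormedModule) F phi); intros u;
      rewrite Rmin_left, Rmax_right by lra; intros Hu; [apply Hd | apply Hc]; lra.
Qed.

Lemma pow_div_fact_le_exp (y : R) (n : nat) :
  0 <= y -> y ^ n <= INR (fact n) * exp y.
Proof.
  intros Hy. assert (H := exp_ge_taylor y n Hy).
  assert (Hn : 0 < INR (fact n)) by (apply lt_0_INR, lt_O_fact).
  assert (T : y ^ n / INR (fact n) <= sum_f_R0 (fun k => y ^ k / INR (fact k)) n).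
  { destruct n as [| n]; [apply Rle_refl | rewrite tech5].
    assert (0 <= sum_f_R0 (fun k => y ^ k / INR (fact k)) n); [| lra].
    apply cond_pos_sum. intros k. apply Rmult_le_pos; [apply pow_le, Hy |].
    left. apply Rinv_0_lt_compat, lt_0_INR, lt_O_fact. }
  replace (y ^ n) with (INR (fact n) * (y ^ n / INR (fact n))) by (field; lra).
  apply Rmult_le_compat_l; lra.
Qed.

(** A power of a logarithm grows more slowly than [1 / sqrt u]: compare
    [y ^ n] with [exp y] at [y = (K - ln u) / 2]. *)
Lemma log_pow_mult_le_sqrt (K u : R) (n : nat) :
  0 < u -> 0 <= K - ln u ->
  u * (K - ln u) ^ n <= 2 ^ n * INR (fact n) * exp (K / 2) * sqrt u.
Proof.
  intros Hu Hy.
  assert (H := pow_div_fact_le_exp ((K - ln u) / 2) n ltac:(lra)).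
  assert (Hs : 0 < sqrt u) by (apply sqrt_lt_R0, Hu).
  assert (Hss : sqrt u * sqrt u = u) by (apply sqrt_sqrt; lra).
  assert (E : exp ((K - ln u) / 2) = exp (K / 2) / sqrt u).
  { rewrite <- Hss at 1. rewrite ln_mult by assumption.
    replace ((K - (ln (sqrt u) + ln (sqrt u))) / 2) with (K / 2 + - ln (sqrt u)) by lra.
    rewrite exp_plus, exp_Ropp, exp_ln by assumption. reflexivity. }
  rewrite E in H.
  replace (K - ln u) with (2 * ((K - ln u) / 2)) by lra.
  rewrite Rpow_mult_distr.
  apply Rle_trans with (u * (2 ^ n * (INR (fact n) * (exp (K / 2) / sqrt u)))).
  - apply Rmult_le_compat_l; [lra |]. apply Rmult_le_compat_l; [| exact H].
    apply pow_le. lra.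
  - right. rewrite <- Hss at 1. field. lra.
Qed.

(** Repeated integration by parts: one step trades a factor [l] for the passage
    from [f 0] to its successor in the chain, since [f 0 * l'] is the derivative
    of [f 1].  The boundary term vanishes at [e] because [l] does, and at [0]
    because [f 0] is linearly small there while [l] is at most logarithmic. *)
Lemma is_RInt_gen_log_moment (l l' : R -> C) (K e : R) (a : nat) :
  0 < e -> l e = 0%C ->
  (forall u, 0 < u <= e -> is_derive_C l u (l' u)) ->
  (forall u, 0 < u <= e -> continuous_C l' u) ->
  (forall u, 0 < u <= e -> Cmod (l u) <= K - ln u) ->
  forall (f : nat -> R -> C) (g : R -> C),
  (forall u, 0 < u <= e -> is_derive_C (f O) u (g u)) ->
  (forall u, 0 < u <= e -> continuous_C g u) ->
  (forall j u, 0 < u <= e -> is_derive_C (f (S j)) u (l' u * f j u)%C) ->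
  (forall j, exists M, forall u, 0 < u <= e -> Cmod (f j u) <= M * u) ->
  @is_RInt_gen C_R_NormedModule (fun u => l u ^ a * g u)%C
    (at_right 0) (at_point e) ((-1) ^ a * INR (fact a) * f a e)%C.
Proof.
  intros He Hle Hl Hl' HK. induction a as [| a IH]; intros f g Hf Hg HfS HM.
  - apply (is_RInt_gen_ext (V := C_R_NormedModule) g).
    { apply filter_forall. intros ab x _. simpl. ring. }
    replace ((-1) ^ 0 * INR (fact 0) * f 0%nat e)%C with (f O e) by (simpl; ring).
    apply is_RInt_gen_primitive; try assumption.
    destruct (HM O) as [M HM0].
    apply (filterlim_sqrt_bound _ (Rmin e 1) (Rabs M)); [apply Rmin_pos; lra |].
    intros u Hu. assert (Hu1 := Rmin_l e 1). assert (Hu2 := Rmin_r e 1).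
    apply Rle_trans with (M * u); [apply HM0; lra |].
    assert (Hs : sqrt u * sqrt u = u) by (apply sqrt_sqrt; lra).
    assert (0 <= sqrt u) by apply sqrt_pos.
    assert (sqrt u <= 1) by (rewrite <- sqrt_1; apply sqrt_le_1; lra).
    assert (M <= Rabs M) by apply Rle_abs. assert (0 <= Rabs M) by apply Rabs_pos.
    apply Rle_trans with (Rabs M * u);
      [apply Rmult_le_compat_r | apply Rmult_le_compat_l]; nra.
  - set (F := fun u => (l u ^ S a * f O u)%C).
    set (phi := fun u => (l u ^ S a * g u + INR (S a) * (l u ^ a * (l' u * f O u)))%C).
    assert (HF : @is_RInt_gen C_R_NormedModule phi (at_right 0) (at_point e) (F e)).
    { apply is_RInt_gen_primitive; [assumption | | |].
      - intros u Hu. eapply is_derive_C_eq.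
        { exact (is_derive_Cmult _ _ _ _ _ (is_derive_Cpow _ _ _ (S a) (Hl u Hu)) (Hf u Hu)). }
        unfold phi. replace (S a - 1)%nat with a by lia. ring.
      - intros u Hu.
        assert (Cl : continuous_C l u) by (eapply is_derive_C_continuous, Hl, Hu).
        assert (Cf : continuous_C (f O) u) by (eapply is_derive_C_continuous, Hf, Hu).
        exact (continuous_plus (V := C_R_NormedModule) _ _ _
          (continuous_Cmult _ _ _ (continuous_Cpow _ _ (S a) Cl) (Hg u Hu))
          (continuous_Cmult _ _ _ (continuous_const (V := C_R_NormedModule) (RtoC (INR (S a))) u)
            (continuous_Cmult _ _ _ (continuous_Cpow _ _ a Cl)
               (continuous_Cmult _ _ _ (Hl' u Hu) Cf)))).
      - destruct (HM O) as [M HM0].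
        apply (filterlim_sqrt_bound _ e (Rabs M * (2 ^ S a * INR (fact (S a)) * exp (K / 2))));
          [assumption |].
        intros u Hu. unfold F. rewrite Cmod_mult, Cmod_pow.
        assert (Hk := HK u Hu). assert (H0 := Cmod_ge_0 (l u)).
        assert (Hp := log_pow_mult_le_sqrt K u (S a) ltac:(lra) ltac:(lra)).
        apply Rle_trans with ((K - ln u) ^ S a * (Rabs M * u)).
        + apply Rmult_le_compat; try apply Cmod_ge_0.
          * apply pow_le, Cmod_ge_0.
          * apply pow_incr. lra.
          * eapply Rle_trans; [apply HM0, Hu |]. apply Rmult_le_compat_r; [lra | apply Rle_abs].
        + replace ((K - ln u) ^ S a * (Rabs M * u)) with (Rabs M * (u * (K - ln u) ^ S a)) by ring.
          rewrite Rmult_assoc. apply Rmult_le_compat_l; [apply Rabs_pos |]. exact Hp. }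
    assert (HI := IH (fun j => f (S j)) (fun u => l' u * f O u)%C).
    assert (HI' := HI (fun u Hu => HfS O u Hu)
      (fun u Hu => continuous_Cmult _ _ _ (Hl' u Hu) (is_derive_C_continuous _ _ _ (Hf u Hu)))
      (fun j u Hu => HfS (S j) u Hu) (fun j => HM (S j))).
    assert (H := is_RInt_gen_minus _ _ _ _ HF (is_RInt_gen_scal _ (INR (S a)) _ HI')).
    replace ((-1) ^ S a * INR (fact (S a)) * f (S a) e)%C with
      (@minus C_R_NormedModule (F e)
        (scal (INR (S a)) ((-1) ^ a * INR (fact a) * f (S a) e)%C)).
    + revert H. apply is_RInt_gen_ext. apply filter_forall. intros ab u _.
      rewrite (scal_R_Cmult (INR (S a))). unfold phi.
      change (l u ^ S a * g u + INR (S a) * (l u ^ a * (l' u * f O u))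
        - INR (S a) * (l u ^ a * (l' u * f O u)) = l u ^ S a * g u)%C.
      ring.
    + rewrite (scal_R_Cmult (INR (S a))). unfold F. rewrite Hle.
      change (0 ^ S a * f O e - INR (S a) * ((-1) ^ a * INR (fact a) * f (S a) e)
        = (-1) ^ S a * INR (fact (S a)) * f (S a) e)%C.
      rewrite fact_simpl, mult_INR, RtoC_mult. simpl Cpow. ring.
Qed.

(** * Closed forms on a rectangle *)

Lemma Rmin_Rmax_convex (I : R -> Prop) (x y : R) :
  (forall a b u, I a -> I b -> a <= u <= b -> I u) -> I x -> I y ->
  forall u, Rmin x y <= u <= Rmax x y -> I u.
Proof.
  intros HI Hx Hy u. unfold Rmin, Rmax.
  destruct (Rle_dec x y); intros Hu; [apply (HI x y) | apply (HI y x)]; assumption.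
Qed.

(** Poincare's lemma: integrate [g] along the side [x = x0], then [f] along the
    horizontal segment.  Differentiating under the integral sign turns the
    [y]-derivative of the second part into the integral of [h], that is,
    into the increment of [g]. *)
Lemma closed_form_primitive (I J : R -> Prop) (x0 y0 : R) (f g h : R -> R -> R) :
  open I -> open J ->
  (forall a b u, I a -> I b -> a <= u <= b -> I u) ->
  (forall a b u, J a -> J b -> a <= u <= b -> J u) ->
  I x0 -> J y0 ->
  (forall x y, I x -> J y -> is_derive (fun y => f x y) y (h x y)) ->
  (forall x y, I x -> J y -> is_derive (fun x => g x y) x (h x y)) ->
  (forall x y, I x -> J y -> continuous (fun x => f x y) x) ->
  (forall y, J y -> continuous (fun y => g x0 y) y) ->
  (forall x y, I x -> J y -> continuous (fun p => h (fst p) (snd p)) (x, y)) ->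
  exists F : R -> R -> R, forall x y, I x -> J y ->
    is_derive (fun x => F x y) x (f x y) /\ is_derive (fun y => F x y) y (g x y).
Proof.
  intros oI oJ cI cJ I0 J0 Hf Hg Cf Cg Ch.
  assert (Ef : forall x y, I x -> J y -> ex_RInt (fun u => f u y) x0 x).
  { intros x y Hx Hy. apply (ex_RInt_continuous (V := R_CompleteNormedModule)).
    intros u Hu. apply Cf; [| assumption].
    apply (Rmin_Rmax_convex I x0 x); assumption. }
  exists (fun x y => RInt (fun v => g x0 v) y0 y + RInt (fun u => f u y) x0 x).
  intros x y Hx Hy. split.
  - evar_last.
    { apply (is_derive_plus (V := R_NormedModule) (fun _ => RInt (fun v => g x0 v) y0 y)
               (fun x => RInt (fun u => f u y) x0 x) x 0 (f x y)).
      - exact (is_derive_const (V := R_NormedModule) _ x).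
      - apply (is_derive_RInt (V := R_NormedModule) (fun u => f u y) _ x0 x); [| apply Cf; assumption].
        apply (filter_imp I); [| exact (oI x Hx)]. intros x' Hx'.
        apply (RInt_correct (V := R_CompleteNormedModule)), Ef; assumption. }
    unfold plus; simpl. ring.
  - assert (Cu : forall u, I u -> continuity_2d_pt (fun v w => Derive (fun z => f w z) v) y u).
    { intros u Hu. apply (continuity_2d_pt_ext_loc (fun v w => h w v)).
      - apply locally_2d_locally.
        assert (HJ : locally (y, u) (fun p : R * R => J (fst p) /\ I (snd p))).
        { destruct (oJ y Hy) as [e1 He1]. destruct (oI u Hu) as [e2 He2].
          exists (mkposreal _ (Rmin_stable_in_posreal e1 e2)). intros [v w] [B1 B2].
          split; [apply He1 | apply He2]; simpl in *.
          - eapply ball_le; [apply Rmin_l | exact B1].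
          - eapply ball_le; [apply Rmin_r | exact B2]. }
        revert HJ. apply filter_imp. intros [v w] [Hv Hw]. simpl in *.
        symmetry. apply is_derive_unique, Hf; assumption.
      - apply continuity_2d_pt_filterlim.
        apply (continuous_comp_2 (fun p : R * R => snd p) (fun p : R * R => fst p) h).
        + apply (continuous_snd (U := R_UniformSpace) (V := R_UniformSpace)).
        + apply (continuous_fst (U := R_UniformSpace) (V := R_UniformSpace)).
        + simpl. apply Ch; assumption. }
    evar_last.
    { apply (is_derive_plus (V := R_NormedModule) (fun y => RInt (fun v => g x0 v) y0 y)
               (fun y => RInt (fun u => f u y) x0 x) y (g x0 y)
               (RInt (fun u => Derive (fun z => f u z) y) x0 x)).
      - apply (is_derive_RInt (V := R_NormedModule) (fun v => g x0 v) _ y0 y); [| apply Cg; assumption].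
        apply (filter_imp J); [| exact (oJ y Hy)]. intros y' Hy'.
        apply (RInt_correct (V := R_CompleteNormedModule)).
        apply (ex_RInt_continuous (V := R_CompleteNormedModule)).
        intros v Hv. apply Cg. apply (Rmin_Rmax_convex J y0 y'); assumption.
      - apply (is_derive_RInt_param (fun y u => f u y) x0 x y).
        + apply (filter_imp J); [| exact (oJ y Hy)]. intros y' Hy' u Hu.
          exists (h u y'). apply Hf; [| assumption].
          apply (Rmin_Rmax_convex I x0 x); assumption.
        + intros u Hu. apply Cu. apply (Rmin_Rmax_convex I x0 x); assumption.
        + apply (filter_imp J); [| exact (oJ y Hy)]. intros y' Hy'. apply Ef; assumption. }
    rewrite (RInt_ext _ (fun u => h u y)).
    + rewrite (is_RInt_unique (fun u => h u y) x0 x (minus (g x y) (g x0 y))).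
      * unfold plus, minus, opp; simpl. unfold plus; simpl. ring.
      * apply (is_RInt_derive (V := R_CompleteNormedModule) (fun u => g u y)).
        -- intros u Hu. apply Hg; [| assumption]. apply (Rmin_Rmax_convex I x0 x); assumption.
        -- intros u Hu.
           apply (continuous_comp_2 (fun u : R => u) (fun _ : R => y) h).
           ++ apply continuous_id.
           ++ apply continuous_const.
           ++ apply Ch; [| assumption]. apply (Rmin_Rmax_convex I x0 x); assumption.
    + intros u Hu. apply is_derive_unique, Hf; [| assumption].
      apply (Rmin_Rmax_convex I x0 x); try assumption. lra.
Qed.

(** * Iterated primitives of dw / w in the chart w = s (1 - exp (-2it)) *)

(** This is [cot t - i], the derivative of [log (1 - exp (-2it))]. *)
Definition log_arc_deriv (t : R) : C := (cos t / sin t, -1).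

(** [D] is the image of [Q] under the Euler operator [w * d/dw].  In the
    coordinates [(s, t)] that operator is [s * d/ds], and holomorphy makes the
    [t]-derivative its product with [w' / w], which does not depend on [s]. *)
Definition euler_derivative (Q D : R -> R -> C) : Prop :=
  forall s t, 0 < s -> 0 < t < PI / 2 ->
  is_derive_C (fun s => Q s t) s (D s t / s)%C /\
  is_derive_C (fun t => Q s t) t (log_arc_deriv t * D s t)%C /\
  continuous_C (fun p : R * R => D (fst p) (snd p)) (s, t).

(** A bound by [M * |w|], up to a constant: the modulus of
    [s * (1 - exp (-2it))] is [2 * s * sin t]. *)
Definition bilinear_bound (z M : R) (Q : R -> R -> C) : Prop :=
  forall s t, 0 < s <= 1 -> 0 < t <= z -> Cmod (Q s t) <= M * s * t.

Lemma sin_pos (t : R) : 0 < t < PI / 2 -> 0 < sin t.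
Proof. intros Ht. apply sin_gt_0; lra. Qed.

Lemma continuous_log_arc_deriv (t : R) :
  0 < t < PI / 2 -> continuous_C log_arc_deriv t.
Proof.
  intros Ht. assert (Hs := sin_pos t Ht).
  apply continuous_C_iff. split.
  - apply (ex_derive_continuous (V := R_NormedModule) (fun t => cos t / sin t)).
    auto_derive. lra.
  - exact (continuous_const (V := R_UniformSpace) (-1) t).
Qed.

Lemma continuous_fst_R (s t : R) : continuous (fun p : R * R => fst p) (s, t).
Proof. apply (continuous_fst (U := R_UniformSpace) (V := R_UniformSpace)). Qed.

Lemma continuous_snd_R (s t : R) : continuous (fun p : R * R => snd p) (s, t).
Proof. apply (continuous_snd (U := R_UniformSpace) (V := R_UniformSpace)). Qed.

Lemma continuous_div_fst (D : R -> R -> C) (s t : R) : 0 < s ->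
  continuous_C (fun p : R * R => D (fst p) (snd p)) (s, t) ->
  continuous_C (fun p : R * R => D (fst p) (snd p) / RtoC (fst p))%C (s, t).
Proof.
  intros Hs H. apply (continuous_Cmult _ _ _ H).
  apply (continuous_Cinv (fun p : R * R => RtoC (fst p))).
  - apply continuous_RtoC, continuous_fst_R.
  - simpl. intros E. injection E. lra.
Qed.

Lemma open_interval (a b : R) : open (fun x => a < x < b).
Proof. apply open_and; [apply open_gt | apply open_lt]. Qed.

Lemma locally_strip (s t : R) : 0 < s -> 0 < t < PI / 2 ->
  locally (s, t) (fun p : R * R => 0 < fst p /\ 0 < snd p < PI / 2).
Proof.
  intros Hs Ht.
  destruct (open_gt 0 s Hs) as [e1 H1].
  destruct (open_interval 0 (PI / 2) t Ht) as [e2 H2].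
  exists (mkposreal _ (Rmin_stable_in_posreal e1 e2)). intros [v w] [B1 B2].
  simpl in *. split; [apply H1 | apply H2].
  - eapply ball_le; [apply Rmin_l | exact B1].
  - eapply ball_le; [apply Rmin_r | exact B2].
Qed.

Lemma euler_derivative_continuous (Q D : R -> R -> C) (s t : R) :
  euler_derivative Q D -> 0 < s -> 0 < t < PI / 2 ->
  continuous_C (fun p : R * R => Q (fst p) (snd p)) (s, t).
Proof.
  intros H Hs Ht. destruct (H s t Hs Ht) as [_ [Dt CD]].
  apply (continuous_div_fst _ _ _ Hs) in CD.
  apply continuous_C_iff in CD. destruct CD as [C1 C2].
  apply is_derive_C_iff in Dt. destruct Dt as [T1 T2].
  apply continuous_C_iff. split.
  - refine (filterdiff_continuous (K := R_AbsRing)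
      (U := prod_NormedModule _ R_NormedModule R_NormedModule)
      (V := R_NormedModule) (fun p : R * R => Re (Q (fst p) (snd p))) (s, t)
      (ex_intro _ _ (is_derive_filterdiff (fun s t => Re (Q s t)) s t
         (fun s t => Re (D s t / s)%C) _ _ T1 C1))).
    generalize (locally_strip s t Hs Ht). apply filter_imp.
    intros [u v] [Hu Hv]. exact (proj1 (proj1 (is_derive_C_iff _ _ _) (proj1 (H u v Hu Hv)))).
  - refine (filterdiff_continuous (K := R_AbsRing)
      (U := prod_NormedModule _ R_NormedModule R_NormedModule)
      (V := R_NormedModule) (fun p : R * R => Im (Q (fst p) (snd p))) (s, t)
      (ex_intro _ _ (is_derive_filterdiff (fun s t => Im (Q s t)) s t
         (fun s t => Im (D s t / s)%C) _ _ T2 C2))).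
    generalize (locally_strip s t Hs Ht). apply filter_imp.
    intros [u v] [Hu Hv]. exact (proj2 (proj1 (is_derive_C_iff _ _ _) (proj1 (H u v Hu Hv)))).
Qed.

(** Both partial derivatives prescribed for [G], namely [Q / s] and
    [log_arc_deriv t * Q], have the mixed derivative [log_arc_deriv t * D / s], so
    the form is closed. *)
Lemma euler_derivative_primitive (Q D : R -> R -> C) :
  euler_derivative Q D -> exists G, euler_derivative G Q.
Proof.
  intros H.
  set (f := fun s t => (Q s t / RtoC s)%C).
  set (g := fun s t => (log_arc_deriv t * Q s t)%C).
  set (h := fun s t => (log_arc_deriv t * (D s t / RtoC s))%C).
  assert (Hf : forall s t, 0 < s -> 0 < t < PI / 2 ->
                 is_derive_C (fun t => f s t) t (h s t)).
  { intros s t Hs Ht. destruct (H s t Hs Ht) as [_ [Dt _]].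
    eapply is_derive_C_eq.
    { exact (is_derive_Cmult _ _ _ _ _ Dt (is_derive_C_const (/ RtoC s) t)). }
    unfold h. field. apply RtoC_neq_0. lra. }
  assert (Hg : forall s t, 0 < s -> 0 < t < PI / 2 ->
                 is_derive_C (fun s => g s t) s (h s t)).
  { intros s t Hs Ht. destruct (H s t Hs Ht) as [Ds _].
    eapply is_derive_C_eq.
    { exact (is_derive_Cmult _ _ _ _ _ (is_derive_C_const (log_arc_deriv t) s) Ds). }
    unfold h. field. apply RtoC_neq_0. lra. }
  assert (Cf : forall s t, 0 < s -> 0 < t < PI / 2 -> continuous_C (fun s => f s t) s).
  { intros s t Hs Ht. destruct (H s t Hs Ht) as [Ds _].
    assert (H0 : s <> 0) by lra.
    exact (is_derive_C_continuous _ _ _ (is_derive_Cdiv_id _ _ _ H0 Ds)). }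
  assert (Cg : forall t, 0 < t < PI / 2 -> continuous_C (fun t => g 1 t) t).
  { intros t Ht. destruct (H 1 t Rlt_0_1 Ht) as [_ [Dt _]].
    exact (continuous_Cmult _ _ _ (continuous_log_arc_deriv t Ht)
             (is_derive_C_continuous _ _ _ Dt)). }
  assert (Ch : forall s t, 0 < s -> 0 < t < PI / 2 ->
                 continuous_C (fun p : R * R => h (fst p) (snd p)) (s, t)).
  { intros s t Hs Ht. destruct (H s t Hs Ht) as [_ [_ CD]].
    apply (continuous_Cmult (fun p : R * R => log_arc_deriv (snd p))).
    - apply (continuous_comp (V := R_UniformSpace) (W := C_R_NormedModule) snd log_arc_deriv).
      + apply continuous_snd_R.
      + apply continuous_log_arc_deriv, Ht.
    - apply continuous_div_fst; assumption. }
  assert (HP : 0 < PI / 4 < PI / 2) by (assert (HPI := PI_RGT_0); lra).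
  destruct (closed_form_primitive (fun s => 0 < s) (fun t => 0 < t < PI / 2) 1 (PI / 4)
     (fun s t => Re (f s t)) (fun s t => Re (g s t)) (fun s t => Re (h s t))) as [F1 HF1];
    try solve [lra | apply open_gt | apply open_interval | intros; simpl in *; lra].
  { intros s t Hs Ht. exact (proj1 (proj1 (is_derive_C_iff _ _ _) (Hf s t Hs Ht))). }
  { intros s t Hs Ht. exact (proj1 (proj1 (is_derive_C_iff _ _ _) (Hg s t Hs Ht))). }
  { intros s t Hs Ht. exact (proj1 (proj1 (continuous_C_iff _ _) (Cf s t Hs Ht))). }
  { intros t Ht. exact (proj1 (proj1 (continuous_C_iff _ _) (Cg t Ht))). }
  { intros s t Hs Ht. exact (proj1 (proj1 (continuous_C_iff _ _) (Ch s t Hs Ht))). }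
  destruct (closed_form_primitive (fun s => 0 < s) (fun t => 0 < t < PI / 2) 1 (PI / 4)
     (fun s t => Im (f s t)) (fun s t => Im (g s t)) (fun s t => Im (h s t))) as [F2 HF2];
    try solve [lra | apply open_gt | apply open_interval | intros; simpl in *; lra].
  { intros s t Hs Ht. exact (proj2 (proj1 (is_derive_C_iff _ _ _) (Hf s t Hs Ht))). }
  { intros s t Hs Ht. exact (proj2 (proj1 (is_derive_C_iff _ _ _) (Hg s t Hs Ht))). }
  { intros s t Hs Ht. exact (proj2 (proj1 (continuous_C_iff _ _) (Cf s t Hs Ht))). }
  { intros t Ht. exact (proj2 (proj1 (continuous_C_iff _ _) (Cg t Ht))). }
  { intros s t Hs Ht. exact (proj2 (proj1 (continuous_C_iff _ _) (Ch s t Hs Ht))). }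
  exists (fun s t => (F1 s t, F2 s t)). intros s t Hs Ht.
  destruct (HF1 s t Hs Ht) as [A1 A2]. destruct (HF2 s t Hs Ht) as [B1 B2].
  split; [| split].
  - apply is_derive_C_iff. split; assumption.
  - apply is_derive_C_iff. split; assumption.
  - exact (euler_derivative_continuous Q D s t H Hs Ht).
Qed.

Lemma cos_mult_le_sin (t z : R) : 0 < t <= z -> z < PI / 2 -> cos z * t <= sin t.
Proof.
  intros Ht Hz. destruct (MVT_gen sin 0 t cos) as [x [Hx E]].
  - intros x _. auto_derive; [trivial | ring].
  - intros x _. apply continuity_sin.
  - rewrite Rmin_left, Rmax_right in Hx by lra. rewrite sin_0 in E.
    assert (cos z <= cos x) by (apply cos_decr_1; lra). nra.
Qed.

Lemma Cmod_log_arc_deriv (t : R) : 0 < sin t -> Cmod (log_arc_deriv t) = / sin t.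
Proof.
  intros Hs. apply Rsqr_inj; [apply Cmod_ge_0 | left; apply Rinv_0_lt_compat, Hs |].
  unfold Rsqr. rewrite Cmod_sqr. simpl. assert (E := sin2_cos2 t). unfold Rsqr in E.
  replace (/ sin t * / sin t) with ((sin t * sin t + cos t * cos t) * (/ sin t * / sin t))
    by (rewrite E; ring).
  field. lra.
Qed.

(** The values of a Lipschitz function form a Cauchy family. *)
Lemma lipschitz_limit_at_right (f : R -> C) (M : R) :
  0 <= M ->
  (forall u v, 0 < u -> u <= v <= 1 -> Cmod (f v - f u) <= M * (v - u)) ->
  exists l : C, forall eps, 0 < eps -> at_right 0 (fun u => Cmod (f u - l) < eps).
Proof.
  intros HM Hf.
  destruct (proj1 (filterlim_locally_cauchy (U := C_R_CompleteNormedModule)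
    (F := at_right 0) f)) as [l Hl].
  - intros eps. set (d := Rmin 1 (eps / (M + 1))).
    assert (Hq : 0 < eps / (M + 1)) by (apply Rdiv_lt_0_compat; [apply cond_pos | lra]).
    assert (Hd : 0 < d) by (apply Rmin_pos; lra).
    assert (d1 : d <= 1) by apply Rmin_l. assert (d2 : d <= eps / (M + 1)) by apply Rmin_r.
    assert (K : forall u v, 0 < u -> u <= v < d -> Cmod (f v - f u) < eps).
    { intros u v Hu Hv. apply Rle_lt_trans with (M * (v - u)); [apply Hf; lra |].
      apply Rle_lt_trans with (M * (eps / (M + 1))); [apply Rmult_le_compat_l; lra |].
      apply Rlt_le_trans with ((M + 1) * (eps / (M + 1))); [nra | right; field; lra]. }
    exists (fun u => 0 < u < d). split; [apply at_right_interval, Hd |].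
    intros u v Hu Hv. destruct (Rle_dec u v) as [L | L].
    + apply (C_NormedModule_mixin_compat1 (f u) (f v)). apply (K u v); lra.
    + apply (ball_sym (M := C_R_CompleteNormedModule)).
      apply (C_NormedModule_mixin_compat1 (f v) (f u)). apply (K v u); lra.
  - exists l. intros eps Heps.
    generalize (proj1 (filterlim_locally_ball_norm (U := C_R_NormedModule) f l) Hl
      (mkposreal eps Heps)).
    apply filter_imp. intros u Hu. rewrite Cmod_norm. exact Hu.
Qed.

(** The constant of integration is fixed by the limit at [s = 0]; that limit does not
    depend on [t] because the [t]-derivative is [O(s)], the pole of
    [log_arc_deriv] at [0] being cancelled by the factor [t] in the bound on [Q]. *)
Lemma euler_derivative_small_primitive (z M : R) (Q D : R -> R -> C) :
  0 < z < PI / 2 -> 0 <= M -> euler_derivative Q D -> bilinear_bound z M Q ->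
  exists G, euler_derivative G Q /\ bilinear_bound z M G.
Proof.
  intros Hz HM HQ HB. destruct (euler_derivative_primitive Q D HQ) as [G HG].
  assert (Hcz : 0 < cos z) by (apply cos_gt_0; lra).
  assert (Ls : forall t u v, 0 < t <= z -> 0 < u -> u <= v <= 1 ->
                 Cmod (G v t - G u t) <= M * t * (v - u)).
  { intros t u v Ht Hu Hv.
    apply (Cmod_increment_le (fun s => G s t) (fun s => Q s t / RtoC s)%C); [lra | |].
    - intros s Hs. apply (HG s t); lra.
    - intros s Hs. assert (Hb := HB s t ltac:(lra) Ht).
      unfold Cdiv. rewrite Cmod_mult, Cmod_inv by (apply RtoC_neq_0; lra).
      rewrite Cmod_R, Rabs_pos_eq by lra.
      apply Rmult_le_reg_r with s; [lra |]. rewrite Rmult_assoc, Rinv_l by lra. lra. }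
  assert (Lt : forall s t, 0 < s <= 1 -> 0 < t <= z ->
                 Cmod (G s z - G s t) <= M * s / cos z * (z - t)).
  { intros s t Hs Ht.
    apply (Cmod_increment_le (fun t => G s t) (fun t => log_arc_deriv t * Q s t)%C); [lra | |].
    - intros v Hv. apply (HG s v); lra.
    - intros v Hv. assert (Hb := HB s v Hs ltac:(lra)).
      assert (Hsn := cos_mult_le_sin v z ltac:(lra) ltac:(lra)).
      assert (Hs0 := sin_pos v ltac:(lra)).
      rewrite Cmod_mult, Cmod_log_arc_deriv by assumption.
      apply Rmult_le_reg_l with (sin v); [assumption |].
      rewrite <- Rmult_assoc, Rinv_r, Rmult_1_l by lra.
      apply Rle_trans with (M * s * v); [assumption |].
      replace (M * s * v) with (cos z * v * (M * s / cos z)) by (field; lra).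
      apply Rmult_le_compat_r; [| assumption].
      apply Rmult_le_pos; [nra | left; apply Rinv_0_lt_compat; assumption]. }
  destruct (lipschitz_limit_at_right (fun s => G s z) (M * z)) as [l Hl].
  { nra. } { intros u v Hu Hv. apply Ls; lra. }
  exists (fun s t => (G s t - l)%C). split.
  - intros s t Hs Ht. destruct (HG s t Hs Ht) as [Ds [Dt CQ]]. split; [| split].
    + eapply is_derive_C_eq.
      { exact (is_derive_minus (V := C_R_NormedModule) _ _ _ _ _ Ds (is_derive_C_const l s)). }
      change (Q s t / s - 0 = Q s t / s)%C. ring.
    + eapply is_derive_C_eq.
      { exact (is_derive_minus (V := C_R_NormedModule) _ _ _ _ _ Dt (is_derive_C_const l t)). }
      change (log_arc_deriv t * Q s t - 0 = log_arc_deriv t * Q s t)%C. ring.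
    + exact CQ.
  - intros s t Hs Ht. apply le_epsilon. intros eps Heps.
    (* Take [u] so small that passing from [t] to [z] at height [u], and from
       there to the limit, costs less than [eps]. *)
    set (N := M / cos z * z + 1).
    assert (HN : 0 < N).
    { assert (0 <= M / cos z * z); [| unfold N; lra].
      apply Rmult_le_pos; [apply Rdiv_le_0_compat |]; lra. }
    assert (Hr : 0 < Rmin s (eps / 2 / N)).
    { apply Rmin_pos; [lra | apply Rdiv_lt_0_compat; lra]. }
    assert (HE := filter_and _ _ (at_right_interval _ Hr) (Hl (eps / 2) ltac:(lra))).
    destruct (filter_ex (F := at_right 0) _ HE) as [u [Hu Hul]].
    assert (Hus : u < s) by (eapply Rlt_le_trans; [apply Hu | apply Rmin_l]).
    assert (Hue : u < eps / 2 / N) by (eapply Rlt_le_trans; [apply Hu | apply Rmin_r]).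
    assert (A := Ls t u s Ht ltac:(lra) ltac:(lra)).
    assert (B := Lt u t ltac:(lra) Ht).
    assert (HNu : N * u < eps / 2).
    { replace (eps / 2) with (N * (eps / 2 / N)) by (field; lra).
      apply Rmult_lt_compat_l; lra. }
    replace (G s t - l)%C with ((G s t - G u t) + ((- (G u z - G u t)) + (G u z - l)))%C by ring.
    eapply Rle_trans; [apply Cmod_triangle |].
    assert (T := Cmod_triangle (- (G u z - G u t)) (G u z - l)).
    rewrite Cmod_opp in T.
    assert (M * t * (s - u) <= M * s * t) by (assert (0 <= M * t) by nra; nra).
    assert (M * u / cos z * (z - t) <= N * u).
    { unfold N. replace (M * u / cos z * (z - t)) with (M / cos z * u * (z - t)) by (field; lra).
      assert (0 <= M / cos z) by (apply Rdiv_le_0_compat; lra).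
      assert (0 <= M / cos z * u) by nra. nra. }
    lra.
Qed.

(** * The logarithm of 1 - s (1 - exp (-2it)) *)

Lemma Cmod_eq_sqrt (w : C) : Cmod w = sqrt (Re w ^ 2 + Im w ^ 2).
Proof. reflexivity. Qed.

(** On the open lower half-plane the argument is [acos] of a value of [cos] at
    a point of [[0, PI]], which turns it into an arctangent, smooth there. *)
Lemma Clog_lower (w : C) : Im w < 0 ->
  Clog w = (ln (Re w ^ 2 + Im w ^ 2) / 2, - (PI / 2) - atan (Re w / Im w)).
Proof.
  intros Hi. set (a := Re w) in *. set (b := Im w) in *.
  assert (Hab : 0 < a ^ 2 + b ^ 2) by nra.
  assert (Hs : 0 < sqrt (a ^ 2 + b ^ 2)) by (apply sqrt_lt_R0, Hab).
  assert (Hss : sqrt (a ^ 2 + b ^ 2) * sqrt (a ^ 2 + b ^ 2) = a ^ 2 + b ^ 2)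
    by (apply sqrt_sqrt; lra).
  unfold Clog. rewrite Cmod_eq_sqrt. fold a b. f_equal.
  - rewrite <- Hss at 2. rewrite ln_mult by assumption. lra.
  - unfold Carg. destruct (Rle_dec 0 (Im w)) as [L | _]; [unfold b in Hi; lra |].
    rewrite Cmod_eq_sqrt. fold a b.
    assert (Hat := atan_bound (a / b)).
    assert (E : a / sqrt (a ^ 2 + b ^ 2) = cos (PI / 2 + atan (a / b))).
    { rewrite cos_plus, cos_PI2, sin_PI2, sin_atan.
      replace (sqrt (1 + (a / b)²)) with (sqrt (a ^ 2 + b ^ 2) / - b).
      - field. lra.
      - symmetry. apply Rsqr_inj; [apply sqrt_pos | |].
        + apply Rdiv_le_0_compat; lra.
        + rewrite Rsqr_sqrt by (assert (H := Rle_0_sqr (a / b)); lra).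
          unfold Rsqr. replace (sqrt (a ^ 2 + b ^ 2) / - b * (sqrt (a ^ 2 + b ^ 2) / - b))
            with (sqrt (a ^ 2 + b ^ 2) * sqrt (a ^ 2 + b ^ 2) / (b * b)) by (field; lra).
          rewrite Hss. field. lra. }
    rewrite E, acos_cos by lra. ring.
Qed.

Lemma is_derive_Clog_lower (w : R -> C) (t : R) (l : C) :
  Im (w t) < 0 -> is_derive_C w t l ->
  is_derive_C (fun x => Clog (w x)) t (l / w t)%C.
Proof.
  intros Hi Hw. assert (Cw := is_derive_C_continuous _ _ _ Hw).
  destruct (proj1 (continuous_C_iff _ _) Cw) as [_ Ci].
  destruct (proj1 (is_derive_C_iff _ _ _) Hw) as [Ha Hb].
  set (a := fun x => Re (w x)) in *. set (b := fun x => Im (w x)) in *.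
  apply (is_derive_ext_loc (V := C_R_NormedModule)
    (fun x => (ln (a x ^ 2 + b x ^ 2) / 2, - (PI / 2) - atan (a x / b x)))).
  { generalize (Ci (fun y => y < 0) (open_lt 0 (b t) Hi)). unfold filtermap.
    apply filter_imp. intros x Hx. symmetry. apply Clog_lower, Hx. }
  assert (Hbt : b t < 0) by exact Hi.
  assert (Hab : 0 < a t ^ 2 + b t ^ 2) by nra.
  assert (El : forall u v, Re ((u, v) / w t)%C = (u * a t + v * b t) / (a t ^ 2 + b t ^ 2) /\
                           Im ((u, v) / w t)%C = (v * a t - u * b t) / (a t ^ 2 + b t ^ 2)).
  { intros u v. unfold a, b, Re, Im, Cdiv, Cinv, Cmult. simpl.
    split; field; simpl in Hab; unfold a, b, Re, Im in Hab; lra. }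
  destruct l as [u v]. simpl in Ha, Hb. destruct (El u v) as [E1 E2].
  apply is_derive_C_iff. rewrite E1, E2. simpl. clear El E1 E2 Hi Hw Cw Ci.
  change (is_derive a t u) in Ha. change (is_derive b t v) in Hb.
  clearbody a b.
  assert (Da : Derive (fun x : R => a x) t = u) by (apply is_derive_unique; exact Ha).
  assert (Db : Derive (fun x : R => b x) t = v) by (apply is_derive_unique; exact Hb).
  split.
  - auto_derive.
    + repeat split; try (now exists u); try (now exists v). nra.
    + rewrite Da, Db.
      field. lra.
  - auto_derive.
    + repeat split; try (now exists u); try (now exists v). lra.
    + rewrite Da, Db.
      unfold Rsqr. field. split; [lra |]. nra.
Qed.

Definition arc_point (t : R) : C := (1 - Cexp (- (2) * Ci * t))%C.

Lemma arc_point_eq (t : R) : arc_point t = (1 - cos (2 * t), sin (2 * t)).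
Proof.
  unfold arc_point, Cexp.
  replace (- (2) * Ci * t)%C with ((0, - (2 * t)) : C)
    by (unfold Ci, Copp, Cmult, RtoC; simpl; f_equal; ring).
  simpl. rewrite exp_0, cos_neg, sin_neg.
  unfold Cminus, Cplus, Copp, RtoC; simpl. f_equal; ring.
Qed.

Lemma sin_2t_pos (t : R) : 0 < t < PI / 2 -> 0 < sin (2 * t).
Proof. intros Ht. apply sin_gt_0; lra. Qed.

Lemma one_minus_arc (s t : R) :
  (1 - arc_point t * s)%C = (1 - s * (1 - cos (2 * t)), - (s * sin (2 * t))).
Proof.
  rewrite arc_point_eq. unfold Cminus, Cplus, Copp, Cmult, RtoC; simpl. f_equal; ring.
Qed.

Lemma Im_one_minus_arc (s t : R) : 0 < s -> 0 < t < PI / 2 ->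
  Im (1 - arc_point t * s)%C < 0.
Proof.
  intros Hs Ht. rewrite one_minus_arc. simpl. assert (H := sin_2t_pos t Ht). nra.
Qed.

Lemma one_minus_arc_neq_0 (s t : R) : 0 < s -> 0 < t < PI / 2 ->
  (1 - arc_point t * s)%C <> 0%C.
Proof.
  intros Hs Ht E. assert (H := Im_one_minus_arc s t Hs Ht). rewrite E in H. simpl in H. lra.
Qed.

Lemma is_derive_arc_point (t : R) : 0 < t < PI / 2 ->
  is_derive_C arc_point t (log_arc_deriv t * arc_point t)%C.
Proof.
  intros Ht. assert (Hs := sin_pos t Ht).
  apply (is_derive_ext (V := C_R_NormedModule) (fun t => (1 - cos (2 * t), sin (2 * t)) : C)).
  { intros x. symmetry. apply arc_point_eq. }
  rewrite arc_point_eq. apply is_derive_C_iff.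
  unfold log_arc_deriv. simpl. rewrite cos_2a_sin, sin_2a. split.
  - auto_derive; [trivial |]. rewrite sin_2a. field. lra.
  - auto_derive; [trivial |]. rewrite cos_2a_cos.
    assert (E := sin2_cos2 t). unfold Rsqr in E.
    replace (sin t * sin t) with (1 - cos t * cos t) by lra.
    field_simplify; [| lra].
    lra.
Qed.

Lemma euler_derivative_log : euler_derivative
  (fun s t => Clog (1 - arc_point t * s)%C)
  (fun s t => (- (arc_point t * s) / (1 - arc_point t * s))%C).
Proof.
  intros s t Hs Ht. assert (HI := Im_one_minus_arc s t Hs Ht).
  assert (H0 := one_minus_arc_neq_0 s t Hs Ht).
  assert (Hs0 : RtoC s <> 0%C) by (apply RtoC_neq_0; lra).
  split; [| split].
  - eapply is_derive_C_eq.
    { apply is_derive_Clog_lower; [exact HI |].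
      apply (is_derive_minus (V := C_R_NormedModule)
        (fun _ => RtoC 1) (fun s => arc_point t * RtoC s)%C).
      - apply is_derive_C_const.
      - apply (is_derive_Cmult (fun _ => arc_point t) RtoC).
        + apply is_derive_C_const.
        + apply (is_derive_RtoC (fun s => s) s 1), (is_derive_id (K := R_AbsRing)). }
    change (((0 - (0 * s + arc_point t * 1)) / (1 - arc_point t * s))%C =
      (- (arc_point t * s) / (1 - arc_point t * s) / s)%C).
    field. split; assumption.
  - eapply is_derive_C_eq.
    { apply is_derive_Clog_lower; [exact HI |].
      apply (is_derive_minus (V := C_R_NormedModule)
        (fun _ => RtoC 1) (fun t => arc_point t * RtoC s)%C).
      - apply is_derive_C_const.
      - apply (is_derive_Cmult arc_point (fun _ => RtoC s)).
        + apply is_derive_arc_point, Ht.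
        + apply is_derive_C_const. }
    change (((0 - ((log_arc_deriv t * arc_point t) * s + arc_point t * 0))
      / (1 - arc_point t * s))%C =
      (log_arc_deriv t * (- (arc_point t * s) / (1 - arc_point t * s)))%C).
    field. assumption.
  - assert (Cw : continuous_C (fun p : R * R => (arc_point (snd p) * fst p)%C) (s, t)).
    { apply (continuous_Cmult (fun p : R * R => arc_point (snd p)) (fun p : R * R => RtoC (fst p))).
      - apply (continuous_comp (V := R_UniformSpace) (W := C_R_NormedModule) snd arc_point).
        + apply continuous_snd_R.
        + exact (is_derive_C_continuous _ _ _ (is_derive_arc_point t Ht)).
      - apply continuous_RtoC, continuous_fst_R. }
    apply (continuous_Cmult (fun p : R * R => (- (arc_point (snd p) * fst p))%C)
      (fun p : R * R => (/ (1 - arc_point (snd p) * fst p))%C)).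
    + exact (continuous_opp (V := C_R_NormedModule) _ _ Cw).
    + apply (continuous_Cinv (fun p : R * R => (1 - arc_point (snd p) * fst p)%C)); [| exact H0].
      exact (continuous_minus (V := C_R_NormedModule) _ _ _
        (continuous_const (V := C_R_NormedModule) (RtoC 1) (s, t)) Cw).
Qed.

Lemma euler_derivative_pow (Q D : R -> R -> C) (n : nat) :
  euler_derivative Q D ->
  euler_derivative (fun s t => Q s t ^ n)%C
    (fun s t => INR n * Q s t ^ (n - 1) * D s t)%C.
Proof.
  intros H s t Hs Ht. destruct (H s t Hs Ht) as [Ds [Dt CD]].
  assert (CQ := euler_derivative_continuous Q D s t H Hs Ht).
  assert (Hs0 : RtoC s <> 0%C) by (apply RtoC_neq_0; lra).
  split; [| split].
  - eapply is_derive_C_eq. { exact (is_derive_Cpow _ _ _ n Ds). }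
    cbv beta. field. exact Hs0.
  - eapply is_derive_C_eq. { exact (is_derive_Cpow _ _ _ n Dt). }
    cbv beta. ring.
  - exact (continuous_Cmult _ _ _ (continuous_Cmult _ _ _
      (continuous_const (V := C_R_NormedModule) (RtoC (INR n)) (s, t))
      (continuous_Cpow _ _ (n - 1) CQ)) CD).
Qed.

Lemma Clog_arc_end (t : R) : 0 < t < PI / 2 ->
  Clog (1 - arc_point t * 1)%C = (- (2) * Ci * t)%C.
Proof.
  intros Ht. rewrite one_minus_arc, !Rmult_1_l.
  replace (1 - (1 - cos (2 * t))) with (cos (2 * t)) by ring.
  assert (Hs := sin_2t_pos t Ht).
  unfold Clog, Carg. rewrite Cmod_eq_sqrt. simpl Re. simpl Im.
  replace (cos (2 * t) ^ 2 + (- sin (2 * t)) ^ 2) with 1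
    by (assert (E := sin2_cos2 (2 * t)); unfold Rsqr in E; nra).
  rewrite sqrt_1, ln_1.
  destruct (Rle_dec 0 (- sin (2 * t))) as [L | _]; [lra |].
  replace (cos (2 * t) / 1) with (cos (2 * t)) by field. rewrite acos_cos by lra.
  unfold Ci, Copp, Cmult, RtoC; simpl; f_equal; ring.
Qed.

(** For small [s] the real part is positive, and the argument is then also given
    by [atan (b s / a s)], which, unlike the expression of [Clog_lower], is
    continuous across [s = 0]. *)
Lemma Clog_arc_limit (t eps : R) : 0 < t < PI / 2 -> 0 < eps ->
  at_right 0 (fun s => Cmod (Clog (1 - arc_point t * s)%C) < eps).
Proof.
  intros Ht He. assert (Hs := sin_2t_pos t Ht). assert (Hc := COS_bound (2 * t)).
  set (a := fun s => 1 - s * (1 - cos (2 * t))).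
  set (b := fun s => - (s * sin (2 * t))).
  set (phi := fun s => (ln (a s ^ 2 + b s ^ 2) / 2, atan (b s / a s)) : C).
  assert (Cphi : continuous_C phi 0).
  { apply continuous_C_iff. unfold phi, a, b. simpl. split.
    - apply (ex_derive_continuous (V := R_NormedModule)
        (fun s => ln ((1 - s * (1 - cos (2 * t))) ^ 2 + (- (s * sin (2 * t))) ^ 2) / 2)).
      auto_derive. nra.
    - apply (ex_derive_continuous (V := R_NormedModule)
        (fun s => atan (- (s * sin (2 * t)) / (1 - s * (1 - cos (2 * t)))))).
      auto_derive. lra. }
  assert (P0 : phi 0 = 0%C).
  { unfold phi, a, b. rewrite !Rmult_0_l, Rminus_0_r, Ropp_0.
    replace (1 ^ 2 + 0 ^ 2) with 1 by ring. rewrite ln_1.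
    replace (0 / 1) with 0 by field. rewrite atan_0. unfold RtoC. f_equal. field. }
  assert (HL := proj1 (filterlim_locally_ball_norm (U := C_R_NormedModule)
    phi (phi 0)) Cphi (mkposreal eps He)).
  assert (HL' : at_right 0 (fun s => Cmod (phi s) < eps)).
  { revert HL. unfold at_right, within. apply filter_imp. intros s Hs2 _.
    change (@norm R_AbsRing C_R_NormedModule (phi s - phi 0)%C < eps) in Hs2.
    rewrite <- Cmod_norm, P0 in Hs2.
    replace (phi s - 0)%C with (phi s) in Hs2 by ring. exact Hs2. }
  generalize (filter_and (F := at_right 0) _ _ (at_right_interval (1 / 2) ltac:(lra)) HL').
  apply filter_imp. intros s [Hs1 Hs2].
  rewrite (Clog_lower _ (Im_one_minus_arc s t (proj1 Hs1) Ht)), one_minus_arc. simpl Re. simpl Im.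
  fold (a s) (b s). unfold phi in Hs2.
  assert (Ha : 0 < a s) by (unfold a; nra). assert (Hb : b s < 0) by (unfold b; nra).
  replace (- (PI / 2) - atan (a s / b s)) with (atan (b s / a s)); [exact Hs2 |].
  assert (Hq : 0 < - b s / a s) by (apply Rdiv_lt_0_compat; lra).
  assert (E := atan_inv _ Hq).
  replace (/ (- b s / a s)) with (- (a s / b s)) in E by (field; lra).
  replace (- b s / a s) with (- (b s / a s)) in E by (field; lra).
  rewrite !atan_opp in E. lra.
Qed.

Lemma Cmod_sqr_one_minus_arc (s t : R) :
  Cmod (1 - arc_point t * s)%C * Cmod (1 - arc_point t * s)%C =
  1 - 4 * s * (1 - s) * (sin t * sin t).
Proof.
  rewrite Cmod_sqr, one_minus_arc. simpl. rewrite cos_2a_sin, sin_2a.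
  assert (E := sin2_cos2 t). unfold Rsqr in E.
  replace (- (s * (2 * sin t * cos t)) * - (s * (2 * sin t * cos t)))
    with (4 * s * s * (sin t * sin t) * (cos t * cos t)) by ring.
  replace (cos t * cos t) with (1 - sin t * sin t) by lra. ring.
Qed.

(** The segment from [1] to [exp (-2it)] is a chord of the unit circle, at
    distance [cos t] from the origin. *)
Lemma cos_le_Cmod_one_minus_arc (s t z : R) : 0 <= s <= 1 -> 0 < t <= z -> z < PI / 2 ->
  cos z <= Cmod (1 - arc_point t * s)%C.
Proof.
  intros Hs Ht Hz.
  assert (Hcz : 0 < cos z) by (apply cos_gt_0; lra).
  assert (Hct : cos z <= cos t) by (apply cos_decr_1; lra).
  assert (E := sin2_cos2 t). unfold Rsqr in E.
  apply Rsqr_incr_0_var; [| apply Cmod_ge_0]. unfold Rsqr.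
  rewrite Cmod_sqr_one_minus_arc.
  assert (0 <= sin t * sin t) by apply Rle_0_sqr.
  assert (4 * s * (1 - s) <= 1) by (assert (0 <= (2 * s - 1) ^ 2) by apply pow2_ge_0; nra).
  assert (cos z * cos z <= cos t * cos t) by nra. nra.
Qed.

Lemma Cmod_arc_point_le (t : R) : 0 < t < PI / 2 -> Cmod (arc_point t) <= 2 * t.
Proof.
  intros Ht. apply Rsqr_incr_0_var; [| lra]. unfold Rsqr. rewrite Cmod_sqr, arc_point_eq.
  simpl. rewrite cos_2a_sin, sin_2a.
  assert (E := sin2_cos2 t). unfold Rsqr in E.
  assert (H := sin_lt_x t ltac:(lra)). assert (H0 := sin_pos t Ht).
  replace (2 * sin t * cos t * (2 * sin t * cos t))
    with (4 * (sin t * sin t) * (cos t * cos t)) by ring.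
  replace (cos t * cos t) with (1 - sin t * sin t) by lra. nra.
Qed.

(** Integrate the [s]-derivative from [0], where the logarithm vanishes. *)
Lemma bilinear_bound_log (z : R) : 0 < z < PI / 2 ->
  bilinear_bound z (2 / cos z) (fun s t => Clog (1 - arc_point t * s)%C).
Proof.
  intros Hz s t Hs Ht. assert (Hcz : 0 < cos z) by (apply cos_gt_0; lra).
  apply le_epsilon. intros eps He.
  destruct (filter_ex (F := at_right 0) _
    (filter_and (F := at_right 0) _ _ (at_right_interval s ltac:(lra))
      (Clog_arc_limit t eps ltac:(lra) He)))
    as [u [Hu Hl]].
  assert (I : Cmod (Clog (1 - arc_point t * s) - Clog (1 - arc_point t * u))%C
              <= 2 * t / cos z * (s - u)).
  { apply (Cmod_increment_le (fun s => Clog (1 - arc_point t * s)%C)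
      (fun s => - (arc_point t * s) / (1 - arc_point t * s) / s)%C); [lra | |].
    - intros v Hv. apply (euler_derivative_log v t); lra.
    - intros v Hv. assert (H0 := one_minus_arc_neq_0 v t ltac:(lra) ltac:(lra)).
      assert (Hs0 : RtoC v <> 0%C) by (apply RtoC_neq_0; lra).
      replace (- (arc_point t * v) / (1 - arc_point t * v) / v)%C
        with (- (arc_point t / (1 - arc_point t * v)))%C by (field; split; assumption).
      rewrite Cmod_opp, Cmod_div by assumption.
      assert (A := Cmod_arc_point_le t ltac:(lra)).
      assert (B := cos_le_Cmod_one_minus_arc v t z ltac:(lra) ltac:(lra) ltac:(lra)).
      apply Rmult_le_compat; [apply Cmod_ge_0 | | assumption |].
      + left. apply Rinv_0_lt_compat. lra.
      + apply Rinv_le_contravar; lra. }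
  replace (Clog (1 - arc_point t * s)%C) with
    ((Clog (1 - arc_point t * s) - Clog (1 - arc_point t * u))
      + Clog (1 - arc_point t * u))%C by ring.
  eapply Rle_trans; [apply Cmod_triangle |].
  assert (2 * t / cos z * (s - u) <= 2 / cos z * s * t).
  { replace (2 / cos z * s * t) with (2 * t / cos z * s) by (field; lra).
    apply Rmult_le_compat_l; [| lra]. apply Rdiv_le_0_compat; lra. }
  lra.
Qed.

Lemma bilinear_bound_pow (z M : R) (Q : R -> R -> C) (n : nat) :
  0 <= M -> bilinear_bound z M Q ->
  bilinear_bound z (M * (M * z) ^ n) (fun s t => Q s t ^ S n)%C.
Proof.
  intros HM HQ s t Hs Ht. rewrite Cmod_pow. simpl pow.
  assert (H := HQ s t Hs Ht). assert (H0 := Cmod_ge_0 (Q s t)).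
  assert (Hle : M * s * t <= M * z).
  { rewrite Rmult_assoc. apply Rmult_le_compat_l; [assumption | nra]. }
  replace (M * (M * z) ^ n * s * t) with ((M * s * t) * (M * z) ^ n) by ring.
  apply Rmult_le_compat; [assumption | apply pow_le; assumption | assumption |].
  apply pow_incr. lra.
Qed.

(** * Nielsen polylogarithms as integrals along the arc *)

Lemma Cpow_opp_1_sqr (n : nat) : ((-1) ^ n * (-1) ^ n = 1)%C.
Proof.
  rewrite <- Cpow_mult_l. replace (-1 * -1)%C with (RtoC 1) by ring.
  apply Cpow_1_l.
Qed.

Lemma euler_chain (z M : R) (Q D : R -> R -> C) :
  0 < z < PI / 2 -> 0 <= M -> euler_derivative Q D -> bilinear_bound z M Q ->
  exists P : nat -> R -> R -> C, P O = Q /\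
    (forall j, euler_derivative (P (S j)) (P j)) /\
    (forall j, bilinear_bound z M (P j)).
Proof.
  intros Hz HM HQ HB.
  set (next := fun Q => epsilon (inhabits Q)
    (fun G => euler_derivative G Q /\ bilinear_bound z M G)).
  assert (Hn : forall Q D, euler_derivative Q D -> bilinear_bound z M Q ->
             euler_derivative (next Q) Q /\ bilinear_bound z M (next Q)).
  { intros Q1 D1 H1 H2. apply (epsilon_spec (inhabits Q1)).
    apply (euler_derivative_small_primitive z M Q1 D1); assumption. }
  exists (fun j => Nat.iter j next Q).
  assert (I : forall j, (exists D, euler_derivative (Nat.iter j next Q) D) /\
                        bilinear_bound z M (Nat.iter j next Q)).
  { induction j as [| j [[D' IH1] IH2]].
    - split; [exists D |]; assumption.
    - destruct (Hn _ _ IH1 IH2) as [A B]. split; [eexists; exact A | exact B]. }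
  split; [reflexivity | split].
  - intros j. destruct (I j) as [[D' IH1] IH2]. apply (Hn _ _ IH1 IH2).
  - intros j. apply I.
Qed.

(** The defining integral runs along the coordinate line [t = z], on which the
    Euler operator is [s * d/ds] and [ln s] is the logarithm with derivative
    [1 / s].  The integrand involves [P 0 / s], the derivative of [P 1]: hence the
    moment lemma is applied to the chain from [P 1] on. *)
Lemma nielsen_eq_chain (P : nat -> R -> R -> C) (z M : R) (a b : nat) :
  0 < z < PI / 2 ->
  (forall s t, P O s t = Clog (1 - arc_point t * s) ^ S b)%C ->
  (forall j, euler_derivative (P (S j)) (P j)) ->
  (forall j, bilinear_bound z M (P j)) ->
  nielsen a (S b) (arc_point z) = ((-1) ^ S b / INR (fact (S b)) * P a 1 z)%C.
Proof.
  intros Hz H0 HP HM. destruct a as [| a].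
  - unfold nielsen. rewrite H0. do 3 f_equal. ring.
  - assert (HI := is_RInt_gen_log_moment (fun s => RtoC (ln s)) (fun s => RtoC (/ s)) 0 1 a
      Rlt_0_1 (f_equal RtoC ln_1)).
    assert (HI' : @is_RInt_gen C_R_NormedModule
       (fun s => RtoC (ln s) ^ a * (P O s z / s))%C (at_right 0) (at_point 1)
       ((-1) ^ a * INR (fact a) * P (S a) 1 z)%C).
    { apply HI with (f := fun j s => P (S j) s z); clear HI.
      - intros u Hu. apply is_derive_RtoC.
        apply is_derive_ln. lra.
      - intros u Hu. apply continuous_RtoC. apply continuous_Rinv; [apply continuous_id | lra].
      - intros u Hu. rewrite Cmod_R, Rabs_left1; [lra |].
        rewrite <- ln_1. apply Rcomplements.ln_le; lra.
      - intros u Hu. apply (HP O u z); lra.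
      - intros u Hu. destruct (HP O u z ltac:(lra) Hz) as [_ [_ C0]].
        apply (continuous_comp_2 (fun s : R => s) (fun _ : R => z)
                 (fun s t => P O s t / RtoC s)%C).
        + apply continuous_id.
        + apply continuous_const.
        + apply continuous_div_fst; [lra | exact C0].
      - intros j u Hu. destruct (HP (S j) u z ltac:(lra) Hz) as [Ds _].
        eapply is_derive_C_eq. { exact Ds. }
        rewrite RtoC_inv by lra. cbv beta. field. apply RtoC_neq_0. lra.
      - intros j. exists (M * z). intros u Hu.
        replace (M * z * u) with (M * u * z) by ring. apply HM; lra. }
    unfold nielsen.
    rewrite (is_RInt_gen_unique (V := C_R_CompleteNormedModule) _
       ((-1) ^ a * INR (fact a) * P (S a) 1 z)%C).
    + replace (S a + S b - 1)%nat with (a + S b)%nat by lia.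
      replace (S a - 1)%nat with a by lia.
      rewrite Cpow_add_r.
      assert (F1 : RtoC (INR (fact a)) <> 0%C) by apply RtoC_neq_0, INR_fact_neq_0.
      assert (F2 : RtoC (INR (fact (S b))) <> 0%C) by apply RtoC_neq_0, INR_fact_neq_0.
      transitivity (((-1) ^ a * (-1) ^ a) *
        ((-1) ^ S b / INR (fact (S b)) * P (S a) 1 z))%C;
        [| rewrite Cpow_opp_1_sqr; ring].
      field. split; assumption.
    + revert HI'. apply is_RInt_gen_ext. apply filter_forall. intros ab s _.
      rewrite H0. replace (S a - 1)%nat with a by lia. rewrite RtoC_pow.
      exact (Cmult_assoc _ _ _).
Qed.

Lemma is_RInt_gen_map {V W : NormedModule R_AbsRing} (T : V -> W) (f : R -> V)
    (Fa Fb : (R -> Prop) -> Prop) (v : V) :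
  Filter Fa -> Filter Fb ->
  (forall a b l, is_RInt f a b l -> is_RInt (fun t => T (f t)) a b (T l)) ->
  continuous T v ->
  is_RInt_gen f Fa Fb v -> is_RInt_gen (fun t => T (f t)) Fa Fb (T v).
Proof.
  intros FA FB HT HC Hf P HP.
  generalize (Hf (fun y => P (T y)) (HC P HP)). unfold filtermapi.
  apply filter_imp. intros [a b] [y [Hy1 Hy2]]. exists (T y).
  split; [apply HT |]; assumption.
Qed.

Lemma is_RInt_gen_Cmult (c : C) (f : R -> C) (Fa Fb : (R -> Prop) -> Prop) (v : C) :
  Filter Fa -> Filter Fb ->
  @is_RInt_gen C_R_NormedModule f Fa Fb v ->
  @is_RInt_gen C_R_NormedModule (fun t => c * f t)%C Fa Fb (c * v)%C.
Proof.
  intros FA FB. apply (is_RInt_gen_map (V := C_R_NormedModule) (W := C_R_NormedModule)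
    (fun w => c * w)%C).
  - assumption.
  - assumption.
  - intros a b l H.
    assert (H1 := is_RInt_fct_extend_fst (U := R_NormedModule) (V := R_NormedModule) _ _ _ _ H).
    assert (H2 := is_RInt_fct_extend_snd (U := R_NormedModule) (V := R_NormedModule) _ _ _ _ H).
    apply (is_RInt_fct_extend_pair (U := R_NormedModule) (V := R_NormedModule)).
    + exact (is_RInt_minus (V := R_NormedModule) _ _ _ _ _ _
        (is_RInt_scal (V := R_NormedModule) _ _ _ (Re c) _ H1)
        (is_RInt_scal (V := R_NormedModule) _ _ _ (Im c) _ H2)).
    + exact (is_RInt_plus (V := R_NormedModule) _ _ _ _ _ _
        (is_RInt_scal (V := R_NormedModule) _ _ _ (Re c) _ H2)
        (is_RInt_scal (V := R_NormedModule) _ _ _ (Im c) _ H1)).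
  - apply (continuous_Cmult (U := C_R_NormedModule) (fun _ => c) (fun w => w)).
    + exact (continuous_const (V := C_R_NormedModule) c v).
    + exact (continuous_id v).
Qed.

(** The logarithm of [arc_point t / arc_point z] that vanishes at [t = z]. *)
Definition log_arc (z t : R) : C := (ln (sin t / sin z), z - t).

(** The coordinate line [s = 1] of the same chain.  There [P 0] is
    [(-2it) ^ (p + 1)], whose derivative is a multiple of [t ^ p]. *)
Lemma is_RInt_gen_nielsen (a p : nat) (z : R) : 0 < z < PI / 2 ->
  @is_RInt_gen C_R_NormedModule (fun t => log_arc z t ^ a * t ^ p)%C
    (at_right 0) (at_point z)
    ((-1) ^ a * INR (fact a) * INR (fact p) / (2 * Ci) ^ S p
      * nielsen a (S p) (arc_point z))%C.
Proof.
  intros Hz. assert (Hcz : 0 < cos z) by (apply cos_gt_0; lra).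
  assert (Hsz := sin_pos z Hz).
  assert (HM : 0 <= 2 / cos z) by (apply Rdiv_le_0_compat; lra).
  set (M := 2 / cos z * (2 / cos z * z) ^ p).
  assert (HM0 : 0 <= M).
  { apply Rmult_le_pos; [assumption | apply pow_le; nra]. }
  destruct (euler_chain z M _ _ Hz HM0
    (euler_derivative_pow _ _ (S p) euler_derivative_log)
    (bilinear_bound_pow _ _ _ p HM (bilinear_bound_log z Hz))) as [P [P0 [HP HB]]].
  rewrite (nielsen_eq_chain P z M a p Hz); try assumption; [| intros; rewrite P0; reflexivity].
  set (g := fun t : R => (INR (S p) * (- (2) * Ci) ^ S p * t ^ p)%C).
  assert (HI : @is_RInt_gen C_R_NormedModule (fun t => log_arc z t ^ a * g t)%C
    (at_right 0) (at_point z) ((-1) ^ a * INR (fact a) * P a 1 z)%C).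
  { apply (is_RInt_gen_log_moment (log_arc z) log_arc_deriv
       (ln (sin z) - ln (cos z) + z) z a) with (f := fun j t => P j 1 t).
    - lra.
    - unfold log_arc. replace (sin z / sin z) with 1 by (field; lra).
      rewrite ln_1. unfold RtoC. f_equal. ring.
    - intros u Hu. assert (Hsu := sin_pos u ltac:(lra)).
      apply is_derive_C_iff. unfold log_arc, log_arc_deriv. simpl. split.
      + auto_derive; [apply Rdiv_lt_0_compat; assumption |]. field. lra.
      + auto_derive; [trivial | ring].
    - intros u Hu. apply continuous_log_arc_deriv. lra.
    - intros u Hu. assert (Hsu := sin_pos u ltac:(lra)).
      assert (Hcu := cos_mult_le_sin u z ltac:(lra) ltac:(lra)).
      assert (Hinc : sin u <= sin z) by (apply sin_incr_1; lra).
      assert (L1 : ln (sin u) <= ln (sin z)) by (apply Rcomplements.ln_le; assumption).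
      assert (L2 : ln (cos z) + ln u <= ln (sin u)).
      { rewrite <- ln_mult by lra. apply Rcomplements.ln_le; [nra | assumption]. }
      unfold log_arc. rewrite ln_div by assumption.
      replace ((ln (sin u) - ln (sin z), z - u) : C) with
        (RtoC (ln (sin u) - ln (sin z)) + Ci * RtoC (z - u))%C
        by (unfold Ci, Cplus, Cmult, RtoC; simpl; f_equal; ring).
      eapply Rle_trans; [apply Cmod_triangle |].
      rewrite Cmod_mult, !Cmod_R, Cmod_Ci, Rabs_left1, Rabs_pos_eq by lra. lra.
    - intros u Hu. rewrite P0.
      apply (is_derive_ext_loc (V := C_R_NormedModule) (fun t => (- (2) * Ci * RtoC t) ^ S p)%C).
      + generalize (open_interval 0 (PI / 2) u ltac:(lra)). apply filter_imp.
        intros t Ht. rewrite Clog_arc_end by assumption. reflexivity.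
      + eapply is_derive_C_eq.
        { apply (is_derive_Cpow (fun t => - (2) * Ci * RtoC t)%C u (- (2) * Ci * 1)%C).
          eapply is_derive_C_eq.
          { apply (is_derive_Cmult (fun _ => (- (2) * Ci)%C) RtoC).
            - apply is_derive_C_const.
            - apply (is_derive_RtoC (fun s => s) u 1), (is_derive_id (K := R_AbsRing)). }
          cbv beta. ring. }
        unfold g. replace (S p - 1)%nat with p by lia. rewrite Cpow_mult_l. simpl Cpow. ring.
    - intros u Hu.
      apply (continuous_Cmult (fun _ => (INR (S p) * (- (2) * Ci) ^ S p)%C) (fun t => RtoC t ^ p)%C).
      + exact (continuous_const (V := C_R_NormedModule) _ u).
      + apply continuous_Cpow, continuous_RtoC, continuous_id.
    - intros j u Hu. apply (HP j 1 u); lra.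
    - intros j. exists M. intros u Hu.
      replace (M * u) with (M * 1 * u) by ring. apply HB; lra. }
  assert (N2 : (2 * Ci)%C <> 0%C).
  { intros E. apply (f_equal Im) in E. simpl in E. lra. }
  assert (N : ((2 * Ci) ^ S p)%C <> 0%C) by (apply Cpow_nz, N2).
  assert (F1 : RtoC (INR (S p)) <> 0%C) by (apply RtoC_neq_0, not_0_INR; lia).
  assert (F2 : RtoC (INR (fact p)) <> 0%C) by apply RtoC_neq_0, INR_fact_neq_0.
  assert (E1 : ((- (2) * Ci) ^ S p = (-1) ^ S p * (2 * Ci) ^ S p)%C).
  { rewrite <- Cpow_mult_l. f_equal. ring. }
  assert (HC := is_RInt_gen_Cmult ((-1) ^ S p / (INR (S p) * (2 * Ci) ^ S p))%C _ _ _ _ _ _ HI).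
  replace ((-1) ^ a * INR (fact a) * INR (fact p) / (2 * Ci) ^ S p
      * ((-1) ^ S p / INR (fact (S p)) * P a 1 z))%C
    with ((-1) ^ S p / (INR (S p) * (2 * Ci) ^ S p)
      * ((-1) ^ a * INR (fact a) * P a 1 z))%C.
  - revert HC. apply is_RInt_gen_ext. apply filter_forall. intros ab t _.
    match goal with |- @eq _ ?x ?y => change (@eq C x y) end.
    unfold g. rewrite E1.
    transitivity (((-1) ^ S p * (-1) ^ S p) * (log_arc z t ^ a * t ^ p))%C.
    + field. split; assumption.
    + rewrite Cpow_opp_1_sqr. ring.
  - rewrite fact_simpl, mult_INR, RtoC_mult.
    field. repeat split; assumption.
Qed.

(** * Expansion of the log-sine integrand *)

Notation sum_C := (@sum_n C_R_NormedModule).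

(* Equalities between values of [sum_C] are typed in the carrier of the module;
   [ring] and [field] recognise them at type [C]. *)
Ltac eq_in_C := match goal with |- @eq _ ?x ?y => change (@eq C x y) end.

Lemma sum_C_S (f : nat -> C) (n : nat) : sum_C f (S n) = (sum_C f n + f (S n))%C.
Proof. exact (sum_Sn (G := C_R_NormedModule) f n). Qed.

Lemma sum_C_0 (f : nat -> C) : sum_C f 0 = f O.
Proof. exact (sum_O (G := C_R_NormedModule) f). Qed.

Lemma sum_C_ext (f g : nat -> C) (n : nat) :
  (forall j, (j <= n)%nat -> f j = g j) -> sum_C f n = sum_C g n.
Proof. exact (sum_n_ext_loc (G := C_R_NormedModule) f g n). Qed.

Lemma sum_C_mult_l (c : C) (f : nat -> C) (n : nat) :
  sum_C (fun j => c * f j)%C n = (c * sum_C f n)%C.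
Proof.
  induction n as [| n IH]; [rewrite !sum_C_0 | rewrite !sum_C_S, IH]; eq_in_C; ring.
Qed.

Lemma sum_C_plus (f g : nat -> C) (n : nat) :
  sum_C (fun j => f j + g j)%C n = (sum_C f n + sum_C g n)%C.
Proof. exact (sum_n_plus (G := C_R_NormedModule) f g n). Qed.

Lemma sum_C_shift (f : nat -> C) (n : nat) :
  sum_C f (S n) = (f O + sum_C (fun j => f (S j)) n)%C.
Proof.
  induction n as [| n IH].
  - rewrite sum_C_S, !sum_C_0. reflexivity.
  - rewrite sum_C_S, IH, sum_C_S. eq_in_C. ring.
Qed.

Definition divided_power (x : C) (n : nat) : C := (x ^ n / INR (fact n))%C.

Lemma INR_fact_neq_0_C (n : nat) : RtoC (INR (fact n)) <> 0%C.
Proof. apply RtoC_neq_0, INR_fact_neq_0. Qed.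

Lemma divided_power_S (x : C) (n : nat) :
  (INR (S n) * divided_power x (S n) = x * divided_power x n)%C.
Proof.
  unfold divided_power. rewrite fact_simpl, mult_INR, RtoC_mult. simpl Cpow.
  assert (RtoC (INR (S n)) <> 0%C) by (apply RtoC_neq_0, not_0_INR; lia).
  field. split; [apply INR_fact_neq_0_C | assumption].
Qed.

(** The binomial theorem without binomial coefficients; in the induction the
    factor [n + 1 = r + (n + 1 - r)] is distributed over the two powers. *)
Lemma divided_power_plus (x y : C) (n : nat) :
  sum_C (fun r => divided_power x r * divided_power y (n - r))%C n =
  divided_power (x + y) n.
Proof.
  induction n as [| n IH].
  - rewrite sum_C_0. unfold divided_power. simpl. eq_in_C. field.
  - assert (N : RtoC (INR (S n)) <> 0%C) by (apply RtoC_neq_0, not_0_INR; lia).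
    assert (E : (INR (S n) * sum_C (fun r => divided_power x r * divided_power y (S n - r))
        (S n) = INR (S n) * divided_power (x + y) (S n))%C).
    { rewrite divided_power_S, <- IH, <- sum_C_mult_l.
      rewrite (sum_C_ext _ (fun r => INR r * divided_power x r * divided_power y (S n - r)
         + divided_power x r * (INR (S n - r) * divided_power y (S n - r)))%C).
      2: { intros r Hr. rewrite (minus_INR (S n) r Hr), RtoC_minus. ring. }
      rewrite sum_C_plus, sum_C_shift, sum_C_S, Nat.sub_diag. change (INR 0) with 0.
      rewrite (sum_C_ext
         (fun r => INR (S r) * divided_power x (S r) * divided_power y (S n - S r))%C
         (fun r => x * (divided_power x r * divided_power y (n - r)))%C).
      2: { intros r _. rewrite divided_power_S. simpl Nat.sub. ring. }
      rewrite (sum_C_ext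
         (fun r => divided_power x r * (INR (S n - r) * divided_power y (S n - r)))%C
         (fun r => y * (divided_power x r * divided_power y (n - r)))%C).
      2: { intros r Hr. rewrite Nat.sub_succ_l by assumption. rewrite divided_power_S. ring. }
      rewrite !sum_C_mult_l. eq_in_C. ring. }
    apply (f_equal (fun u => / INR (S n) * u)%C) in E.
    rewrite !Cmult_assoc, !Cinv_l, !Cmult_1_l in E by assumption. exact E.
Qed.

Lemma is_RInt_gen_sum_C (f : nat -> R -> C) (v : nat -> C)
    (Fa Fb : (R -> Prop) -> Prop) (n : nat) :
  Filter Fa -> Filter Fb ->
  (forall j, (j <= n)%nat -> @is_RInt_gen C_R_NormedModule (f j) Fa Fb (v j)) ->
  @is_RInt_gen C_R_NormedModule (fun t => sum_C (fun j => f j t) n) Fa Fb (sum_C v n).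
Proof.
  intros FA FB. induction n as [| n IH]; intros H.
  - rewrite sum_C_0. generalize (H O (le_n _)). apply is_RInt_gen_ext.
    apply filter_forall. intros ab t _. symmetry. apply sum_C_0.
  - rewrite sum_C_S.
    assert (IH' := IH (fun j Hj => H j (le_S _ _ Hj))).
    generalize (is_RInt_gen_plus _ _ _ _ IH' (H (S n) (le_n _))). apply is_RInt_gen_ext.
    apply filter_forall. intros ab t _. symmetry. apply sum_C_S.
Qed.

(** Convergence of the real integral comes for free from the real part; the
    imaginary part of [v] is the integral of [0]. *)
Lemma RtoC_RInt_gen (f : R -> R) (Fa Fb : (R -> Prop) -> Prop) (v : C) :
  ProperFilter Fa -> ProperFilter Fb ->
  @is_RInt_gen C_R_NormedModule (fun t => RtoC (f t)) Fa Fb v ->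
  RtoC (RInt_gen f Fa Fb) = v.
Proof.
  intros FA FB H.
  destruct (proj1 (continuous_C_iff (U := C_R_NormedModule) (fun w => w) v)
              (continuous_id v)) as [C1 C2].
  assert (H1 := is_RInt_gen_map (V := C_R_NormedModule) (W := R_NormedModule) Re _
    Fa Fb v _ _ (is_RInt_fct_extend_fst (U := R_NormedModule) (V := R_NormedModule) _) C1 H).
  assert (H2 := is_RInt_gen_map (V := C_R_NormedModule) (W := R_NormedModule) Im _
    Fa Fb v _ _ (is_RInt_fct_extend_snd (U := R_NormedModule) (V := R_NormedModule) _) C2 H).
  change (is_RInt_gen (V := R_NormedModule) f Fa Fb (Re v)) in H1.
  change (is_RInt_gen (V := R_NormedModule) (fun _ => 0) Fa Fb (Im v)) in H2.
  assert (H3 : is_RInt_gen (V := R_NormedModule) (fun _ => 0) Fa Fb 0).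
  { generalize (is_RInt_gen_scal _ 0 _ H2).
    change (is_RInt_gen (V := R_NormedModule) (fun _ => 0 * 0) Fa Fb (0 * Im v) ->
      is_RInt_gen (V := R_NormedModule) (fun _ => 0) Fa Fb 0).
    rewrite !Rmult_0_l. trivial. }
  rewrite (is_RInt_gen_unique (V := R_CompleteNormedModule) f _ H1).
  assert (E : Im v = 0).
  { rewrite <- (is_RInt_gen_unique (V := R_CompleteNormedModule) _ _ H2).
    exact (is_RInt_gen_unique (V := R_CompleteNormedModule) _ _ H3). }
  rewrite (surjective_pairing v). unfold RtoC. f_equal. symmetry. exact E.
Qed.

(** [ln (sin t / sin z)] is [log_arc z t + i (t - z)]; expand this power, then the
    powers of [t - z]. *)
Lemma log_sine_power_expansion (z t : R) (k n : nat) :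
  (RtoC (- / INR (fact n) * (t ^ k * ln (sin t / sin z) ^ n)))%C =
  sum_C (fun j => sum_C (fun r =>
    - (Ci ^ j * (- z) ^ r / (INR (fact r) * INR (fact (j - r)) * INR (fact (n - j))))
    * (log_arc z t ^ (n - j) * t ^ (k + j - r)))%C j) n.
Proof.
  transitivity (sum_C (fun j => (- t ^ k) *
    (divided_power (Ci * (t - z)) j * divided_power (log_arc z t) (n - j)))%C n).
  - rewrite sum_C_mult_l, divided_power_plus. unfold divided_power.
    replace (Ci * (t - z) + log_arc z t)%C with (RtoC (ln (sin t / sin z)))
      by (unfold log_arc, Ci, Cminus, Cplus, Copp, Cmult, RtoC; simpl; f_equal; ring).
    rewrite RtoC_mult, RtoC_opp, RtoC_inv, RtoC_mult, !RtoC_pow by apply INR_fact_neq_0.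
    field. apply INR_fact_neq_0_C.
  - apply sum_C_ext. intros j Hj.
    transitivity ((- t ^ k * Ci ^ j * divided_power (log_arc z t) (n - j)) *
      sum_C (fun r => divided_power (- z) r * divided_power t (j - r)) j)%C.
    + rewrite divided_power_plus. unfold divided_power at 1 4.
      rewrite Cpow_mult_l. replace (- z + t)%C with (t - z)%C by ring.
      unfold Cdiv. ring.
    + rewrite <- sum_C_mult_l. apply sum_C_ext. intros r Hr.
      unfold divided_power. replace (k + j - r)%nat with (k + (j - r))%nat by lia.
      rewrite Cpow_add_r. field. repeat split; apply INR_fact_neq_0_C.
Qed.

(** With [j = r + q] and [n - j = d], this compares the powers of [i] and [-1] in
    the term [(j, r)] of the expansion with those in the stated sum,
    both multiplied by the factor [i ^ (k + q + 1)] that comes from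
    [is_RInt_gen_nielsen]. *)
Lemma log_sine_coefficient_sign (k q r d : nat) :
  (Ci ^ S (k + q) * ((-1) ^ (d + (r + q) + k + 1 + (r + q) + r + 1) * Ci ^ (r + k + 1)))%C =
  (- (Ci ^ (r + q) * (-1) ^ r * (-1) ^ d))%C.
Proof.
  assert (I2 : (Ci ^ S (k + q) * Ci ^ (r + k + 1) = - ((-1) ^ k * Ci ^ (r + q)))%C).
  { rewrite <- Cpow_add_r.
    replace (S (k + q) + (r + k + 1))%nat with (2 * S k + (r + q))%nat by lia.
    rewrite Cpow_add_r, Cpow_mult_r.
    replace (Ci ^ 2)%C with (RtoC (-1)).
    - simpl Cpow. ring.
    - unfold Ci, Cmult, RtoC; simpl; unfold Cmult; simpl; f_equal; ring. }
  assert (S2 : ((-1) ^ (d + (r + q) + k + 1 + (r + q) + r + 1)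
    = (-1) ^ k * (-1) ^ d * (-1) ^ r)%C).
  { replace (d + (r + q) + k + 1 + (r + q) + r + 1)%nat
      with ((S (r + q) + S (r + q)) + (k + d + r))%nat by lia.
    rewrite (Cpow_add_r _ (S (r + q) + S (r + q))), (Cpow_add_r _ (S (r + q))), Cpow_opp_1_sqr.
    rewrite !Cpow_add_r. ring. }
  rewrite S2.
  transitivity (((-1) ^ d * (-1) ^ r * (-1) ^ k) * (Ci ^ S (k + q) * Ci ^ (r + k + 1)))%C; [ring |].
  rewrite I2.
  transitivity (- (((-1) ^ k * (-1) ^ k) * (Ci ^ (r + q) * (-1) ^ r * (-1) ^ d)))%C; [ring |].
  rewrite Cpow_opp_1_sqr. ring.
Qed.

Theorem corollary3p2 (m k : nat) (z : R) (hkm : (k < m)%nat)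
    (hz : 0 < z < PI / 2) :
  (ls m k z / INR (fact (m - k - 1)))%C =
  sum_n (fun j : nat =>
    sum_n (fun r : nat =>
      (INR (fact (k + j - r)) / (INR (fact r) * INR (fact (j - r))) *
       ((-1) ^ (m + j + r + 1) * Ci ^ (r + k + 1) / 2 ^ (k + j + 1 - r)) *
       z ^ r *
       nielsen (m - k - 1 - j) (k + j + 1 - r) (1 - Cexp (- (2) * Ci * z)))%C)
      j)
    (m - k - 1).
Proof.
  set (n := (m - k - 1)%nat).
  unfold ls. replace (m - 1 - k)%nat with n by lia.
  assert (H : forall j, (j <= n)%nat -> forall r, (r <= j)%nat ->
    @is_RInt_gen C_R_NormedModule (fun t =>
      - (Ci ^ j * (- z) ^ r / (INR (fact r) * INR (fact (j - r)) * INR (fact (n - j))))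
      * (log_arc z t ^ (n - j) * t ^ (k + j - r)))%C (at_right 0) (at_point z)
      (INR (fact (k + j - r)) / (INR (fact r) * INR (fact (j - r))) *
       ((-1) ^ (m + j + r + 1) * Ci ^ (r + k + 1) / 2 ^ (k + j + 1 - r)) *
       z ^ r *
       nielsen (n - j) (k + j + 1 - r) (1 - Cexp (- (2) * Ci * z)))%C).
  { intros j Hj r Hr. fold (arc_point z).
    replace (k + j + 1 - r)%nat with (S (k + j - r)) by lia.
    assert (HN := is_RInt_gen_Cmult
      (- (Ci ^ j * (- z) ^ r / (INR (fact r) * INR (fact (j - r)) * INR (fact (n - j)))))%C
      _ _ _ _ _ _ (is_RInt_gen_nielsen (n - j) (k + j - r) z hz)).
    revert HN. fold n. generalize (nielsen (n - j) (S (k + j - r)) (arc_point z)).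
    intros N HN.
    evar_last; [exact HN | clear HN].
    destruct (Nat.le_exists_sub _ _ Hj) as [d [Hd _]].
    destruct (Nat.le_exists_sub _ _ Hr) as [q [Hq _]].
    rewrite Nat.add_comm in Hd, Hq. subst j.
    replace (k + (r + q) - r)%nat with (k + q)%nat by lia.
    replace (r + q - r)%nat with q by lia.
    replace (n - (r + q))%nat with d by lia.
    replace m with (d + (r + q) + k + 1)%nat by (unfold n in Hd; lia).
    assert (NI : (Ci ^ S (k + q))%C <> 0%C).
    { apply Cpow_nz. intros E. apply (f_equal Im) in E. simpl in E. lra. }
    assert (N2 : (2 ^ S (k + q))%C <> 0%C) by (apply Cpow_nz, RtoC_neq_0; lra).
    assert (Fr := INR_fact_neq_0_C r). assert (Fq := INR_fact_neq_0_C q).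
    assert (Fd := INR_fact_neq_0_C d).
    transitivity (INR (fact (k + q)) / (INR (fact r) * INR (fact q)) *
      (- (Ci ^ (r + q) * (-1) ^ r * (-1) ^ d) / Ci ^ S (k + q) / 2 ^ S (k + q)) * z ^ r * N)%C.
    - replace (- z)%C with (-1 * z)%C by ring. rewrite !Cpow_mult_l.
      field. repeat split; assumption.
    - rewrite <- (log_sine_coefficient_sign k q r d). field. repeat split; assumption. }
  assert (HS := is_RInt_gen_sum_C _ _ _ _ n _ _ (fun j Hj =>
    is_RInt_gen_sum_C _ _ _ _ j _ _ (H j Hj))).
  set (rhs := sum_C _ n) in HS at 1. transitivity rhs; [| reflexivity].
  (* The expansion is that of the integrand divided by [- n!]. *)
  assert (HI := is_RInt_gen_Cmult (- INR (fact n))%C _ _ _ _ _ _ HS).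
  assert (E := RtoC_RInt_gen (fun t => t ^ k * ln (sin t / sin z) ^ n)
    (at_right 0) (at_point z) (- INR (fact n) * rhs)%C _ _).
  rewrite RtoC_opp, E.
  - field. apply INR_fact_neq_0_C.
  - revert HI. apply is_RInt_gen_ext. apply filter_forall. intros ab t _.
    rewrite <- log_sine_power_expansion.
    rewrite RtoC_mult, RtoC_opp, RtoC_inv by apply INR_fact_neq_0.
    eq_in_C. field. apply INR_fact_neq_0_C.
Qed.
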